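(* Let $D\ge 1$ and let $g\in C^\infty$ be a Riemannian metric on $\mathbb{R}^D$ written as $g_x(u,v)=u^{\top}H(x)v$ with $H(x)\in\mathbb{R}^{D\times D}$, such that there exist $c_1,c_2>0$ with $c_1\|u\|_2^2\le g_x(u,u)\le c_2\|u\|_2^2$ for all $x,u\in\mathbb{R}^D$, and there exists $L_H\ge 0$ with $\|H(x)-H(y)\|_{\mathcal{B}}\le L_H\|x-y\|_2$ for all $x,y\in\mathbb{R}^D$. Let $X^{(0)},X^{(1)}\subset\mathbb{R}^D$ be non-empty closed sets, at least one of which is bounded. Then there exists a constant $C$ depending only on $c_1,c_2,L_H,d^g(X^{(0)},X^{(1)}),X^{(0)},X^{(1)}$ such that for every $N\ge 1$ and every minimizer $\gamma^{*\mathrm{p}}_{\mathrm{tra},N}\in\operatorname{argmin}_{\gamma^{\mathrm{p}}\in\mathcal{C}^N_{\mathrm{p}}(X^{(0)},X^{(1)})}\mathcal{E}^g_{\mathrm{tra},N}(\gamma^{\mathrm{p}})$, with linear interpolation $\gamma^{*\mathrm{pl}}_{\mathrm{tra},N}$, $$\min_{\gamma\in\mathcal{C}_{\mathrm{ps}}(X^{(0)},X^{(1)})}\mathcal{E}^g(\gamma)-\frac{C}{N^{1/2}}\le \mathcal{E}^g(\gamma^{*\mathrm{pl}}_{\mathrm{tra},N})-\frac{C}{N^{1/2}}\le \mathcal{E}^g_{\mathrm{tra},N}(\gamma^{*\mathrm{p}}_{\mathrm{tra},N})\le \min_{\gamma\in\mathcal{C}_{\mathrm{ps}}(X^{(0)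},X^{(1)})}\mathcal{E}^g(\gamma)+\frac{C}{N}.$$
   Context: $\|\cdot\|_2$ is the Euclidean norm and $\|A\|_{\mathcal{B}}=\sup_{x\ne0}\|Ax\|_2/\|x\|_2$ the operator norm. $\mathcal{C}_{\mathrm{ps}}$ is the set of continuous piecewise $C^1$ curves $\gamma:[0,1]\to\mathbb{R}^D$, and $\mathcal{C}_{\mathrm{ps}}(X^{(0)},X^{(1)})=\{\gamma\in\mathcal{C}_{\mathrm{ps}}:\gamma(0)\in X^{(0)},\gamma(1)\in X^{(1)}\}$. Energy and length: $\mathcal{E}^g(\gamma)=\int_0^1 g_{\gamma(t)}(\dot\gamma(t),\dot\gamma(t))\,dt$, $\mathcal{L}^g(\gamma)=\int_0^1 g_{\gamma(t)}(\dot\gamma(t),\dot\gamma(t))^{1/2}dt$. Distance: $d^g(x,y)=\inf\{\mathcal{L}^g(\gamma):\gamma\in\mathcal{C}_{\mathrm{ps}},\gamma(0)=x,\gamma(1)=y\}$ and $d^g(X^{(0)},X^{(1)})=\inf_{x\in X^{(0)},y\in X^{(1)}}d^g(x,y)$. For $N\ge1$ put $t_n=n/N$ ($n=0,\dots,N$), $h=1/N$. $\mathcal{C}^N_{\mathrm{p}}$ is the set of maps $\gamma^{\mathrm{p}}:\{t_0,\dots,t_N\}\to\mathbb{R}^D$, and $\mathcal{C}^N_{\mathrm{p}}(X^{(0)},X^{(1)})$ those with $\gamma^{\mathrm{p}}(0)\in X^{(0)}$, $\gamma^{\mathrm{p}}(1)\in X^{(1)}$. Finite differences: $\beta^{\mathrm{p}}(t_n)=(\gamma^{\mathrm{p}}(t_{n+1})-\gamma^{\mathrm{p}}(t_n))/h$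 for $n=0,\dots,N-1$. The linear interpolation $\gamma^{\mathrm{pl}}$ of $\gamma^{\mathrm{p}}$ is $\gamma^{\mathrm{pl}}(t_n+s)=(1-Ns)\gamma^{\mathrm{p}}(t_n)+Ns\,\gamma^{\mathrm{p}}(t_{n+1})$ for $0\le s\le h$. Trapezoidal-rule energy: $\mathcal{E}^g_{\mathrm{tra},N}(\gamma^{\mathrm{p}})=\frac1N\sum_{n=0}^{N-1}g_{(\gamma^{\mathrm{p}}(t_n)+\gamma^{\mathrm{p}}(t_{n+1}))/2}(\beta^{\mathrm{p}}(t_n),\beta^{\mathrm{p}}(t_n))$. *)

(* Defs.v *)
From HB Require Import structures.
From mathcomp Require Import all_boot all_order all_algebra.
From mathcomp Require Import all_classical all_reals all_analysis.
Set Implicit Arguments. Unset Strict Implicit. Unset Printing Implicit Defensive.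
Import Order.TTheory GRing.Theory Num.Theory.
Import numFieldNormedType.Exports.
Local Open Scope classical_set_scope.
Local Open Scope ring_scope.

Section Defs.
Variables (R : realType) (D : nat).
Notation V := 'rV[R]_D.

Definition norm2 {m n : nat} (A : 'M[R]_(m, n)) : R :=
  Num.sqrt (\sum_(i < m) \sum_(j < n) A i j ^+ 2).

Definition opnorm (A : 'M[R]_D) : R :=
  sup [set norm2 (A *m u^T) / norm2 u | u in [set u : V | u != 0]].

Definition gmet (H : V -> 'M[R]_D) (x u v : V) : R := (u *m H x *m v^T) 0 0.

Fixpoint Ck (k : nat) (f : V -> R) : Prop :=
  match k with
  | 0 => continuous f
  | k.+1 => continuous f /\ (forall x v, derivable f x v) /\
            (forall v, Ck k (fun x => 'D_v f x))
  end.
Definition smooth (f : V -> R) : Prop := forall k, Ck k f.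

Definition C1curve (phi : R -> V) : Prop :=
  (forall t, derivable phi t 1) /\ continuous (derive1 phi).

Definition pcurve (gam : R -> V) : Prop :=
  {within `[0, 1], continuous gam} /\
  exists (k : nat) (s : nat -> R),
    s 0%N = 0 /\ s k = 1 /\ (forall i, (i < k)%N -> s i < s i.+1) /\
    forall i, (i < k)%N -> exists phi, C1curve phi /\
      forall t, s i <= t <= s i.+1 -> gam t = phi t.

Definition pcurve_between (X0 X1 : set V) (gam : R -> V) : Prop :=
  pcurve gam /\ X0 (gam 0) /\ X1 (gam 1).

Definition energy (H : V -> 'M[R]_D) (gam : R -> V) : R :=
  Rintegral (@lebesgue_measure R) `[0, 1]
    (fun t => gmet H (gam t) (derive1 gam t) (derive1 gam t)).

Definition length (H : V -> 'M[R]_D) (gam : R -> V) : R :=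
  Rintegral (@lebesgue_measure R) `[0, 1]
    (fun t => Num.sqrt (gmet H (gam t) (derive1 gam t) (derive1 gam t))).

Definition gdist (H : V -> 'M[R]_D) (x y : V) : R :=
  inf [set length H gam | gam in [set gam | pcurve gam /\ gam 0 = x /\ gam 1 = y]].

Definition gsetdist (H : V -> 'M[R]_D) (X0 X1 : set V) : R :=
  inf [set r | exists x y, X0 x /\ X1 y /\ r = gdist H x y].

(* discrete curves: gp n = gamma^p(t_n), t_n = n/N *)
Definition Etra (H : V -> 'M[R]_D) (N : nat) (gp : 'I_N.+1 -> V) : R :=
  N%:R^-1 * \sum_(n < N)
    (let beta := N%:R *: (gp (inord n.+1) - gp (inord n)) in
     gmet H (2^-1 *: (gp (inord n) + gp (inord n.+1))) beta beta).

Definition is_tra_minimizer (H : V -> 'M[R]_D) (X0 X1 : set V) (N : nat)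
    (gp : 'I_N.+1 -> V) : Prop :=
  X0 (gp ord0) /\ X1 (gp ord_max) /\
  forall gq : 'I_N.+1 -> V, X0 (gq ord0) -> X1 (gq ord_max) -> Etra H gp <= Etra H gq.

Definition lin_interp (N : nat) (gp : 'I_N.+1 -> V) (t : R) : V :=
  let n := minn `|Num.floor (t * N%:R)|%N N.-1 in
  let s := t - n%:R / N%:R in
  (1 - N%:R * s) *: gp (inord n) + (N%:R * s) *: gp (inord n.+1).

End Defs.

(* Main.v *)
(* The minimising curve is obtained as a limit of discrete minimisers.  Comparing
   with the straight segment bounds the discrete energy of a minimiser by a
   constant.  Moving one interior node (a discrete Euler-Lagrange inequality,
   for which [H] need only be Lipschitz) shows that the momenta
   [gmet H m_n beta_n] have bounded variation, so the velocities [beta_n] are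
   bounded by a constant [K] and [O(1/N)]-Lipschitz along the grid, uniformly in
   [N].  A limit of the discrete minimisers along an ultrafilter is therefore a
   C^1 curve with speed at most [K], and the convergence is strong enough to pass
   to the limit in the energies.  It minimises the energy because sampling a
   curve of speed at most [K] on the grid increases its energy by at most
   [L K^3 / N]: this uses the convexity of the form at the midpoint, the Lipschitz
   bound on [H], and no second derivative.  Conversely, interpolating linearly
   between nodes of velocity at most [K] increases the energy by at most
   [L K^3 / N].  All three inequalities follow with [C = L K^3]. *)
Require Import Defs.
From HB Require Import structures.
From mathcomp Require Import all_boot all_order all_algebra.
From mathcomp Require Import all_classical all_reals all_analysis.
From mathcomp Require Import measurable_realfun ring lra.
Import Order.TTheory GRing.Theory Num.Theory.
Import numFieldNormedType.Exports.
Set Implicit Arguments. Unset Strict Implicit. Unset Printing Implicit Defensive.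
Local Open Scope classical_set_scope.
Local Open Scope ring_scope.

(** Piecewise [C^1] curves are not closed under limits of minimising sequences. On a fixed grid the
    problem is finite-dimensional, and the regularity that the limit needs is already present in the
    discrete minimisers, with constants free of [N]. The speed bound is drawn from the energy alone:
    the momentum jump at a node is of order [L / N] times squared speeds, so all jumps together are
    controlled by [L] times the mean square speed, while some cell moves no faster than the root
    mean square. The limit curve inherits [K], so one constant serves the discrete and the
    continuous minimisers. Its cube is a displacement [K / N] of the base point, weighted by [L],
    times a squared speed. An ultrafilter gives limits at all times at once, but only pointwise;
    Lipschitz bounds and a finite grid make them uniform. Energies are compared through primitives:
    an inequality of integrals becomes the monotonicity of a function whose derivative has a sign
    off finitely many points. *)

(** * The metric as a bilinear form, the Euclidean norm and the operator norm *)

Section Forms.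
Variables (R : realType) (D : nat).
Notation V := 'rV[R]_D.
Implicit Types (H : V -> 'M[R]_D) (x y u v w : V) (a : R).

Lemma gmetE H x u v : gmet H x u v = \sum_i \sum_j u 0 i * H x i j * v 0 j.
Proof.
rewrite /gmet mxE exchange_big/=; apply: eq_bigr => j _.
by rewrite !mxE mulr_suml.
Qed.

Lemma gmetDl H x u v w : gmet H x (u + v) w = gmet H x u w + gmet H x v w.
Proof. by rewrite /gmet !mulmxDl mxE. Qed.

Lemma gmetZl H x a u w : gmet H x (a *: u) w = a * gmet H x u w.
Proof. by rewrite /gmet -!scalemxAl mxE. Qed.

Lemma gmetNl H x u w : gmet H x (- u) w = - gmet H x u w.
Proof. by rewrite -scaleN1r gmetZl mulN1r. Qed.

Lemma gmetDr H x u v w : gmet H x w (u + v) = gmet H x w u + gmet H x w v.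
Proof. by rewrite /gmet linearD mulmxDr mxE. Qed.

Lemma gmetZr H x a u w : gmet H x w (a *: u) = a * gmet H x w u.
Proof. by rewrite /gmet linearZ -scalemxAr mxE. Qed.

Lemma gmetNr H x u w : gmet H x w (- u) = - gmet H x w u.
Proof. by rewrite -scaleN1r gmetZr mulN1r. Qed.

Definition gmet_lin := (gmetDl, gmetDr, gmetNl, gmetNr, gmetZl, gmetZr).

Lemma gmetC H x u v : (H x)^T = H x -> gmet H x u v = gmet H x v u.
Proof.
move=> sH; rewrite /gmet.
have -> : u *m H x *m v^T = (v *m H x *m u^T)^T by rewrite !trmx_mul trmxK sH mulmxA.
by rewrite mxE.
Qed.

(** The discriminant of the nonnegative polynomial [q]. The form is only semidefinite here, so the
    leading coefficient [c] may vanish. *)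
Lemma gmet_CauchySchwarz H x u v : (H x)^T = H x ->
  (forall w, 0 <= gmet H x w w) ->
  gmet H x u v ^+ 2 <= gmet H x u u * gmet H x v v.
Proof.
move=> sH H0; set a := gmet H x u u; set b := gmet H x u v.
set c := gmet H x v v.
have q t : 0 <= a + 2 * t * b + t ^+ 2 * c.
  have := H0 (u + t *: v).
  rewrite !gmet_lin (gmetC v u) // -/a -/b -/c; congr (_ <= _); ring.
have c_ge0 : 0 <= c by exact: H0.
clearbody a b c.
have [c0|c0] := eqVneq c 0.
  have [->|b0] := eqVneq b 0; first by rewrite c0; lra.
  (* With [c = 0] the polynomial is affine in [t], and this [t] gives it the value [-1]. *)
  have := q (- (a + 1) / (2 * b)).
  have -> : a + 2 * (- (a + 1) / (2 * b)) * b + (- (a + 1) / (2 * b)) ^+ 2 * c = -1.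
    by rewrite c0; field.
  by lra.
have cp : 0 < c by rewrite lt_neqAle eq_sym c0.
have := q (- b / c); rewrite -(pmulr_lge0 _ cp).
have -> : (a + 2 * (- b / c) * b + (- b / c) ^+ 2 * c) * c = a * c - b ^+ 2.
  by field.
by rewrite subr_ge0.
Qed.

(** The Euclidean inner product as the constant identity metric, so that bilinearity,
    Cauchy-Schwarz, continuity and differentiation of [gmet] apply to it. *)
Definition ip u v : R := gmet (fun=> 1%:M) 0 u v.

Lemma ipE u v : ip u v = \sum_j u 0 j * v 0 j.
Proof. by rewrite /ip /gmet mulmx1 mxE; apply: eq_bigr => j _; rewrite mxE. Qed.

Lemma norm2_ge0 m n (A : 'M[R]_(m, n)) : 0 <= norm2 A.
Proof. exact: sqrtr_ge0. Qed.

Lemma norm2_sqr m n (A : 'M[R]_(m, n)) :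
  norm2 A ^+ 2 = \sum_i \sum_j A i j ^+ 2.
Proof.
by rewrite sqr_sqrtr// sumr_ge0// => i _; rewrite sumr_ge0// => j _; exact: sqr_ge0.
Qed.

Lemma ipxx u : ip u u = norm2 u ^+ 2.
Proof.
by rewrite norm2_sqr big_ord1 ipE; apply: eq_bigr => j _; rewrite expr2.
Qed.

Lemma ip_le u v : `|ip u v| <= norm2 u * norm2 v.
Proof.
rewrite -ler_sqr ?nnegrE ?mulr_ge0 ?norm2_ge0// real_normK ?num_real//.
rewrite exprMn -!ipxx; apply: gmet_CauchySchwarz; first exact: trmx1.
by move=> w; rewrite -/(ip w w) ipxx sqr_ge0.
Qed.

Lemma norm2D u v : norm2 (u + v) <= norm2 u + norm2 v.
Proof.
rewrite -ler_sqr ?nnegrE ?addr_ge0 ?norm2_ge0// sqrrD -!ipxx /ip !gmet_lin.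
rewrite (gmetC (H := fun=> 1%:M) v u) ?trmx1// -!/(ip _ _).
by have := ip_le u v; rewrite ler_norml; lra.
Qed.

Lemma norm2Z a u : norm2 (a *: u) = `|a| * norm2 u.
Proof.
apply/eqP; rewrite -(@eqrXn2 _ 2) ?mulr_ge0 ?norm2_ge0//; apply/eqP.
rewrite exprMn -!ipxx /ip !gmet_lin real_normK ?num_real//.
by rewrite mulrA expr2.
Qed.

Lemma norm2N u : norm2 (- u) = norm2 u.
Proof. by rewrite -scaleN1r norm2Z normrN1 mul1r. Qed.

Lemma norm2B u v : norm2 (u - v) = norm2 (v - u).
Proof. by rewrite -norm2N opprB. Qed.

Lemma norm2_0 : norm2 (0 : V) = 0.
Proof. by rewrite -(scale0r 0) norm2Z normr0 mul0r. Qed.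

Lemma norm2_distD w u v : norm2 (u - v) <= norm2 (u - w) + norm2 (w - v).
Proof. by apply: le_trans (norm2D _ _); rewrite subrKA. Qed.

Lemma norm2_eq0 u : norm2 u = 0 -> u = 0.
Proof.
move=> u0; apply/rowP => j; rewrite mxE; apply/eqP; rewrite -sqrf_eq0.
have : \sum_j u 0 j ^+ 2 == 0.
  by have := norm2_sqr u; rewrite u0 expr0n big_ord1/= => <-.
rewrite psumr_eq0 => [|i _]; last exact: sqr_ge0.
by move=> /allP/(_ j); rewrite mem_index_enum => /(_ isT)/implyP; exact.
Qed.

(** The topology on row vectors comes from the maximum norm; this comparison and the converse one
    below carry limits and boundedness over to [norm2]. *)
Lemma mx_norm_le_norm2 u : `|u| <= norm2 u.
Proof.
rewrite /Num.Def.normr/= mx_normrE; apply: bigmax_le => [|[i j] _].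
  exact: norm2_ge0.
rewrite -ler_sqr ?nnegrE ?norm2_ge0// real_normK ?num_real//= norm2_sqr.
rewrite big_ord1 (bigD1 j)//= (ord1 i) lerDl sumr_ge0// => k _.
exact: sqr_ge0.
Qed.

Lemma norm2_le_mx_norm u : norm2 u <= D%:R * `|u|.
Proof.
rewrite -ler_sqr ?nnegrE ?mulr_ge0 ?norm2_ge0// norm2_sqr big_ord1.
apply: (@le_trans _ _ (\sum_(j < D) `|u| ^+ 2)).
  apply: ler_sum => j _.
  rewrite -[_ ^+ 2]real_normK ?num_real// ler_sqr ?nnegrE//.
  rewrite [leRHS]/Num.Def.normr/= mx_normrE.
  exact: (le_trans _ (le_bigmax _ (fun i : 'I_1 * 'I_D => `|u i.1 i.2|) (0, j))).
rewrite sumr_const card_ord -[leLHS]mulr_natl exprMn.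
apply: ler_wpM2r; first exact: sqr_ge0.
by rewrite -natrX ler_nat; case: (D) => // n; rewrite expnS leq_pmulr.
Qed.

(** On matrices [norm2] is the Frobenius norm. It bounds the quotients in [opnorm] from above,
    without which their [sup] would carry no information. *)
Lemma norm2_mulmx (A : 'M[R]_D) u : norm2 (A *m u^T) <= norm2 A * norm2 u.
Proof.
rewrite -ler_sqr ?nnegrE ?mulr_ge0 ?norm2_ge0// exprMn !norm2_sqr.
rewrite mulr_suml; apply: ler_sum => i _; rewrite !big_ord1.
rewrite (_ : (A *m u^T) i 0 = ip (row i A) u).
  apply: (@le_trans _ _ ((norm2 (row i A) * norm2 u) ^+ 2)).
    rewrite -real_normK ?num_real//.
    by rewrite ler_sqr ?nnegrE ?mulr_ge0 ?norm2_ge0// ip_le.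
  rewrite exprMn !norm2_sqr !big_ord1 (eq_bigr (fun j => A i j ^+ 2))// => j _.
  by rewrite mxE.
by rewrite ipE mxE; apply: eq_bigr => j _; rewrite !mxE.
Qed.

Lemma opnormP (A : 'M[R]_D) u : norm2 (A *m u^T) <= opnorm A * norm2 u.
Proof.
have [->|u0] := eqVneq u 0.
  rewrite norm2_0 mulr0; apply: le_trans (norm2_mulmx _ _) _.
  by rewrite norm2_0 mulr0.
have nu : 0 < norm2 u.
  by rewrite lt_neqAle norm2_ge0 andbT eq_sym; apply: contra_neq u0 => /norm2_eq0.
rewrite -ler_pdivrMr//; apply: ub_le_sup; last by exists u.
exists (norm2 A) => _ [w /= w0 <-].
have nw : 0 < norm2 w.
  by rewrite lt_neqAle norm2_ge0 andbT eq_sym; apply: contra_neq w0 => /norm2_eq0.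
by rewrite ler_pdivrMr// norm2_mulmx.
Qed.

(** The form in which every later estimate uses the Lipschitz bound on [H]: Cauchy-Schwarz against
    the vector [(H x - H y) v]. *)
Lemma gmet_lip H L x y u v :
  (forall x y, opnorm (H x - H y) <= L * norm2 (x - y)) ->
  `|gmet H x u v - gmet H y u v| <= L * norm2 (x - y) * norm2 u * norm2 v.
Proof.
move=> lip.
rewrite (_ : _ - _ = ip u ((H x - H y) *m v^T)^T).
  have -> : L * norm2 (x - y) * norm2 u * norm2 v =
      norm2 u * (L * norm2 (x - y) * norm2 v) by ring.
  apply: le_trans (ip_le _ _) _; rewrite ler_wpM2l ?norm2_ge0//.
  have -> : norm2 ((H x - H y) *m v^T)^T = norm2 ((H x - H y) *m v^T).
    rewrite /norm2 exchange_big; congr Num.sqrt; apply: eq_bigr => i _.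
    by apply: eq_bigr => j _; rewrite mxE.
  apply: le_trans (opnormP _ _) _; rewrite ler_wpM2r ?norm2_ge0//.
rewrite /ip /gmet mulmx1 trmxK mulmxA mulmxBr mulmxBl.
by rewrite [in RHS]mxE [in X in _ = _ + X]mxE.
Qed.

End Forms.

(** * Elementary inequalities and finite sums *)

(** All passages [e -> 0] go through this form: the restriction [e <= 1] lets estimates absorb
    [e ^+ 2] into [e]. *)
Lemma ler_addgt0_mul (R : realType) (a b C : R) :
  (forall e, 0 < e -> e <= 1 -> a <= b + e * C) -> a <= b.
Proof.
move=> h; apply/ler_addgt0Pr => e e0.
have C1 : 0 < `|C| + 1 by rewrite ltr_wpDl.
pose d := Num.min 1 (e / (`|C| + 1)).
have d0 : 0 < d by rewrite lt_min ltr01 divr_gt0.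
have d1 : d <= 1 by rewrite ge_min lexx.
apply: le_trans (h d d0 d1) _; rewrite lerD2l.
apply: (@le_trans _ _ (d * (`|C| + 1))).
  by rewrite ler_wpM2l ?(ltW d0)// (le_trans (ler_norm C))// lerDl.
by rewrite -ler_pdivlMr// ge_min lexx orbT.
Qed.

(** Turns a bound on a form tested against its own argument into a bound on the norm, including the
    case where that norm is zero. *)
Lemma ler_sqr_of_mul (R : realType) (c a n : R) :
  0 < c -> 0 <= a -> c * n ^+ 2 <= a * n -> n <= a / c.
Proof.
move=> c0 a0 h; rewrite ler_pdivlMr//; have [n0|n0] := leP n 0.
  by apply: le_trans a0; rewrite pmulr_lle0.
by rewrite -(ler_pM2r n0) (le_trans _ h)// expr2 mulrA (mulrC c).
Qed.

(** Moving one node of a discrete curve changes just the two cells that meet there. *)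
Lemma sumB_eq2 (R : realType) N (F F' : nat -> R) (n : nat) : (n.+1 < N)%N ->
  (forall i, i != n -> i != n.+1 -> F' i = F i) ->
  \sum_(i < N) F' i - \sum_(i < N) F i = (F' n - F n) + (F' n.+1 - F n.+1).
Proof.
move=> nN h; have n'N : (n < N)%N by exact: ltnW.
rewrite (bigD1 (Ordinal n'N))//= (bigD1 (Ordinal nN))//=; last first.
  by rewrite -val_eqE/= gtn_eqF.
rewrite [X in _ - X](bigD1 (Ordinal n'N))//= [X in _ - (_ + X)](bigD1 (Ordinal nN))//=; last first.
  by rewrite -val_eqE/= gtn_eqF.
under eq_bigr => i /andP[i1 i2] do rewrite h//.
by ring.
Qed.

Lemma ler_sum_widen (R : realType) (F : nat -> R) i N : (i <= N)%N ->
  (forall n, 0 <= F n) -> \sum_(n < i) F n <= \sum_(n < N) F n.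
Proof.
move=> iN F0; rewrite -!(big_mkord xpredT F) [leRHS](@big_cat_nat _ _ _ i)//=.
by rewrite lerDl sumr_ge0.
Qed.

(** * Speed and acceleration bounds for discrete critical curves *)

Section Discrete.
Variables (R : realType) (D : nat).
Notation V := 'rV[R]_D.
Variables (H : V -> 'M[R]_D) (c1 c2 L : R).
Hypothesis symH : forall x, (H x)^T = H x.
Hypothesis c1_gt0 : 0 < c1.
Hypothesis c2_gt0 : 0 < c2.
Hypothesis ellH : forall x u,
  c1 * norm2 u ^+ 2 <= gmet H x u u /\ gmet H x u u <= c2 * norm2 u ^+ 2.
Hypothesis L_ge0 : 0 <= L.
Hypothesis lipH : forall x y, opnorm (H x - H y) <= L * norm2 (x - y).
Implicit Types (x y : nat -> V) (u v w : V).

Lemma gmet_ge0 z u : 0 <= gmet H z u u.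
Proof.
by apply: le_trans (ellH z u).1; rewrite mulr_ge0 ?sqr_ge0// ltW.
Qed.

Lemma gmet_le z u v : `|gmet H z u v| <= c2 * norm2 u * norm2 v.
Proof.
rewrite -ler_sqr ?nnegrE ?mulr_ge0 ?norm2_ge0 ?(ltW c2_gt0)//.
rewrite real_normK ?num_real//.
apply: le_trans (gmet_CauchySchwarz _ _ (symH z) (gmet_ge0 z)) _.
have -> : (c2 * norm2 u * norm2 v) ^+ 2 =
    (c2 * norm2 u ^+ 2) * (c2 * norm2 v ^+ 2) by ring.
by apply: ler_pM; rewrite ?gmet_ge0// (ellH _ _).2.
Qed.

(** Discrete curves are indexed by all of [nat], so that [x n.+1] needs no cast; only the values at
    [0] to [N] enter [Edisc N]. *)
Definition vel N x n : V := N%:R *: (x n.+1 - x n).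
Definition mid x n : V := 2^-1 *: (x n + x n.+1).
Definition Edisc N x : R :=
  N%:R^-1 * \sum_(n < N) gmet H (mid x n) (vel N x n) (vel N x n).

(** Minimality with both endpoints fixed: moving an interior node keeps a competitor admissible
    whatever the endpoint sets are. *)
Definition disc_critical N x :=
  forall y, y 0%N = x 0%N -> y N = x N -> Edisc N x <= Edisc N y.

(** Exact expansion of the form at [z], plus a Lipschitz error for the moved base point. That error
    is of first order in [d], so it survives division by [e] and becomes the right-hand side of the
    momentum inequality. *)
Lemma gmet_shift z d u w :
  gmet H (z + d) (u + w) (u + w) <=
  gmet H z u u + 2 * gmet H z u w + gmet H z w w +
  L * norm2 d * norm2 (u + w) ^+ 2.
Proof.
have := gmet_lip (z + d) z (u + w) (u + w) lipH.
have -> : z + d - z = d by rewrite addrAC subrr add0r.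
rewrite ler_norml => /andP[_].
rewrite !gmet_lin (gmetC (x := z) w u)// (gmetC (x := z + d) w u)//.
set l := L * _ * _ * _; have -> : L * norm2 d * norm2 (u + w) ^+ 2 = l.
  by rewrite /l expr2 !mulrA.
by lra.
Qed.

(* Moving the node [n.+1] by [e v / N] and letting [e] tend to 0 gives the
   discrete Euler-Lagrange equation as an inequality, without differentiating
   [H]. *)
Lemma momentum_step1 N x n v : (n.+1 < N)%N -> disc_critical N x ->
  gmet H (mid x n.+1) (vel N x n.+1) v - gmet H (mid x n) (vel N x n) v <=
  L / (4 * N%:R) * norm2 v * (norm2 (vel N x n) ^+ 2 + norm2 (vel N x n.+1) ^+ 2).
Proof.
move=> nN crit; have N0 : 0 < N%:R :> R by rewrite ltr0n; case: N nN {crit}.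
set b := vel N x n; set b' := vel N x n.+1; set m := mid x n; set m' := mid x n.+1.
(* [Q] and [T] collect what is of second order in [e]: the cost of the perturbation itself, and the
   growth of the squared speeds inside the Lipschitz error. *)
pose Q := gmet H m v v + gmet H m' v v.
pose T := norm2 v * (2 * norm2 b + 2 * norm2 b' + norm2 v * 2).
apply: (@ler_addgt0_mul _ _ _ (Q / 2 + L / (4 * N%:R) * norm2 v * T)) => e e0 e1.
(* With the displacement [(e / N) v] the two adjacent velocities change by exactly [e v] and
   [- e v], and both midpoints by [(e / (2 N)) v]. *)
pose y k := if k == n.+1 then x k + (e / N%:R) *: v else x k.
have yn k : k != n.+1 -> y k = x k by rewrite /y => /negbTE ->.
have yn1 : y n.+1 = x n.+1 + (e / N%:R) *: v by rewrite /y eqxx.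
have /crit : y 0%N = x 0%N by rewrite yn.
have yN : y N = x N by rewrite yn// gtn_eqF.
move=> /(_ yN); rewrite /Edisc ler_pM2l ?invr_gt0// -subr_ge0.
rewrite (@sumB_eq2 _ N (fun n => gmet H (mid x n) (vel N x n) (vel N x n))
  (fun n => gmet H (mid y n) (vel N y n) (vel N y n)) n)//; last first.
  by move=> i i1 i2; rewrite /mid /vel !yn.
have Ne : N%:R * (e / N%:R) = e by rewrite mulrC divfK// gt_eqF.
have -> : vel N y n = b + e *: v.
  by rewrite /b /vel yn1 yn ?ltn_eqF// addrAC scalerDr scalerA Ne.
have -> : vel N y n.+1 = b' + (- e) *: v.
  rewrite /b' /vel yn1 (yn n.+2) ?gtn_eqF// opprD addrA scalerDr.
  by rewrite scalerN scalerA Ne scaleNr.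
have -> : mid y n = m + (e / (2 * N%:R)) *: v.
  rewrite /m /mid yn1 yn ?ltn_eqF// addrA scalerDr scalerA.
  by congr (_ + _ *: _); field; rewrite gt_eqF.
have -> : mid y n.+1 = m' + (e / (2 * N%:R)) *: v.
  rewrite /m' /mid yn1 (yn n.+2) ?gtn_eqF// addrAC scalerDr scalerA.
  by congr (_ + _ *: _); field; rewrite gt_eqF.
rewrite -/b -/b' -/m -/m'; clearbody b b' m m'.
have s1 := gmet_shift m ((e / (2 * N%:R)) *: v) b (e *: v).
have s2 := gmet_shift m' ((e / (2 * N%:R)) *: v) b' (- e *: v).
rewrite !gmetZr !gmetZl in s1 s2.
have nd : norm2 ((e / (2 * N%:R)) *: v) = e / (2 * N%:R) * norm2 v.
  by rewrite norm2Z ger0_norm// divr_ge0// ltW// mulr_gt0.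
have nb w a : `|a| = e -> norm2 (w + a *: v) ^+ 2 <=
    norm2 w ^+ 2 + e * (norm2 v * (2 * norm2 w + norm2 v)).
  move=> ae; apply: (@le_trans _ _ ((norm2 w + e * norm2 v) ^+ 2)).
    rewrite ler_sqr ?nnegrE ?addr_ge0 ?mulr_ge0 ?norm2_ge0 ?(ltW e0)//.
    by apply: le_trans (norm2D _ _) _; rewrite norm2Z ae.
  have nv := norm2_ge0 v.
  have : e * (e * norm2 v ^+ 2) <= e * (1 * norm2 v ^+ 2).
    by rewrite ler_pM2l// ler_wpM2r// sqr_ge0.
  by move: (norm2 w) (norm2 v) => p q; rewrite sqrrD; nra.
have n1 := nb b e (ger0_norm (ltW e0)).
have n2 : norm2 (b' + - e *: v) ^+ 2 <= _ := nb b' (- e) _.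
have {}n2 := n2 (etrans (normrN e) (ger0_norm (ltW e0))).
rewrite nd in s1 s2.
have k0 : 0 <= L * (e / (2 * N%:R) * norm2 v).
  by rewrite !mulr_ge0 ?norm2_ge0// ?invr_ge0 ltW// mulr_gt0.
have {}s1 := le_trans s1 (lerD (lexx _) (ler_wpM2l k0 n1)).
have {}s2 := le_trans s2 (lerD (lexx _) (ler_wpM2l k0 n2)).
move=> s0.
(* The linear terms of the two cells have opposite signs, so minimality leaves [2 * e] times the
   difference of momenta. *)
rewrite -(ler_pM2l (_ : 0 < 2 * e)); last by lra.
rewrite /T /Q.
have -> : 2 * e * (L / (4 * N%:R) * norm2 v * (norm2 b ^+ 2 + norm2 b' ^+ 2) +
  e * ((gmet H m v v + gmet H m' v v) / 2 + L / (4 * N%:R) * norm2 v *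
    (norm2 v * (2 * norm2 b + 2 * norm2 b' + norm2 v * 2)))) =
  L * (e / (2 * N%:R) * norm2 v) * (norm2 b ^+ 2 + norm2 b' ^+ 2 +
     e * (norm2 v * (2 * norm2 b + norm2 v)) + e * (norm2 v * (2 * norm2 b' + norm2 v)))
  + e * (e * (gmet H m v v + gmet H m' v v)).
  by field; rewrite gt_eqF.
set k := L * (e / (2 * N%:R) * norm2 v) in s1 s2 k0 *.
move: s0 s1 s2.
move: (gmet _ (m + _) _ _) (gmet _ (m' + _) _ _) => A A'.
move: (norm2 b ^+ 2) (norm2 b' ^+ 2) (e * (norm2 v * (2 * norm2 b + norm2 v)))
  (e * (norm2 v * (2 * norm2 b' + norm2 v))) => B B' Z Z'.
clearbody k.
move: (gmet H m b v) (gmet H m v v) (gmet H m' b' v) (gmet H m' v v) => *.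
by lra.
Qed.

Lemma momentum_step N x n v : (n.+1 < N)%N -> disc_critical N x ->
  `|gmet H (mid x n.+1) (vel N x n.+1) v - gmet H (mid x n) (vel N x n) v| <=
  L / (4 * N%:R) * norm2 v * (norm2 (vel N x n) ^+ 2 + norm2 (vel N x n.+1) ^+ 2).
Proof.
move=> nN crit; rewrite ler_norml momentum_step1// andbT.
have := momentum_step1 (- v) nN crit; rewrite norm2N !gmetNr.
by rewrite opprK addrC lerNl opprB.
Qed.

(** Writing the energy bound as [c1 * B] makes [B] a bound on the mean square speed. *)
Lemma sum_vel_le N x B : (0 < N)%N -> Edisc N x <= c1 * B ->
  \sum_(n < N) norm2 (vel N x n) ^+ 2 <= N%:R * B.
Proof.
move=> N0 EB; rewrite -(ler_pM2l c1_gt0) mulr_sumr.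
apply: (@le_trans _ _ (\sum_(n < N) gmet H (mid x n) (vel N x n) (vel N x n))).
  by apply: ler_sum => n _; exact: (ellH _ _).1.
have N0' : 0 < N%:R :> R by rewrite ltr0n.
by move: EB; rewrite /Edisc ler_pdivrMl// mulrCA.
Qed.

(** Sum of the jumps from cell [0] to cell [n]. Each squared speed is counted at most twice, so the
    sums amount to at most [2 * N * B] and cancel the [N] in [L / (4 * N)]. *)
Lemma momentum_dist N x n v B : (n < N)%N -> disc_critical N x ->
  Edisc N x <= c1 * B ->
  `|gmet H (mid x n) (vel N x n) v - gmet H (mid x 0) (vel N x 0) v| <=
  L * B / 2 * norm2 v.
Proof.
move=> nN crit EB; have N0 : (0 < N)%N by case: N nN {crit EB}.
have N0' : 0 < N%:R :> R by rewrite ltr0n.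
have k0 : 0 <= L / (4 * N%:R) * norm2 v.
  by rewrite !mulr_ge0 ?norm2_ge0 ?invr_ge0 ?mulr_ge0.
set F := fun n => norm2 (vel N x n) ^+ 2.
have F0 i : 0 <= F i by exact: sqr_ge0.
have main : `|gmet H (mid x n) (vel N x n) v - gmet H (mid x 0) (vel N x 0) v| <=
    L / (4 * N%:R) * norm2 v * (\sum_(i < n) F i + \sum_(i < n.+1) F i).
  elim: n nN => [|n IH] nN.
    by rewrite subrr normr0 mulr_ge0// addr_ge0// sumr_ge0.
  apply: le_trans (ler_distD (gmet H (mid x n) (vel N x n) v) _ _) _.
  apply: le_trans (lerD (momentum_step v nN crit) (IH (ltnW nN))) _.
  rewrite -mulrDr ler_wpM2l// [in leRHS]big_ord_recr/= [X in _ <= _ + X]big_ord_recr/=.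
  by rewrite -/(F n) -/(F n.+1); lra.
apply: le_trans main _.
have s1 : \sum_(i < n) F i <= N%:R * B.
  by apply: le_trans (sum_vel_le N0 EB); apply: ler_sum_widen => //; exact: ltnW.
have s2 : \sum_(i < n.+1) F i <= N%:R * B.
  by apply: le_trans (sum_vel_le N0 EB); apply: ler_sum_widen.
apply: le_trans (ler_wpM2l k0 (lerD s1 s2)) _.
by rewrite le_eqVlt; apply/orP; left; apply/eqP; field; rewrite gt_eqF.
Qed.

(* [c2 sqrt B] bounds the momentum of some cell, [L B] its variation. *)
Definition speed_bound B : R := (c2 * Num.sqrt B + L * B) / c1.

Lemma speed_bound_ge0 B : 0 <= B -> 0 <= speed_bound B.
Proof.
move=> B0; rewrite divr_ge0 ?(ltW c1_gt0)// addr_ge0// ?mulr_ge0 ?sqrtr_ge0//.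
exact: ltW.
Qed.

(** Some cell [n0] has speed at most [sqrt B], since [B] bounds the mean square. Going from its
    momentum to that of cell [n] through cell [0] costs [L * B / 2] twice; testing the momentum on
    the velocity itself converts it into a speed. *)
Lemma vel_le N x n B : 0 <= B -> (n < N)%N -> disc_critical N x ->
  Edisc N x <= c1 * B -> norm2 (vel N x n) <= speed_bound B.
Proof.
move=> B0 nN crit EB; have N0 : (0 < N)%N by case: N nN {crit EB}.
have [n0 n0N hn0] : exists2 n0, (n0 < N)%N & norm2 (vel N x n0) <= Num.sqrt B.
  apply: contrapT => hn.
  have := sum_vel_le N0 EB; apply/negP; rewrite -ltNge.
  have -> : N%:R * B = \sum_(i < N) B by rewrite sumr_const card_ord mulr_natl.
  apply: ltr_sum => [|i _].
    by apply/hasP; exists (Ordinal N0); rewrite ?mem_index_enum.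
  rewrite ltNge; apply/negP => hi; apply: hn; exists i => //.
  by rewrite -[leLHS](ger0_norm (norm2_ge0 _)) -sqrtr_sqr; exact: ler_wsqrtr.
apply: ler_sqr_of_mul => //.
  by rewrite addr_ge0// ?mulr_ge0 ?sqrtr_ge0// ltW.
apply: le_trans (ellH (mid x n) _).1 _; set w := vel N x n.
have d1 := momentum_dist w nN crit EB.
have d2 := momentum_dist w n0N crit EB.
have d3 : gmet H (mid x n0) (vel N x n0) w <= c2 * Num.sqrt B * norm2 w.
  apply: le_trans (ler_norm _) _; apply: le_trans (gmet_le _ _ _) _.
  by rewrite ler_wpM2r ?norm2_ge0// ler_wpM2l// ltW.
move: d1 d2; rewrite !ler_norml -/w => /andP[_ d1] /andP[d2 _].
rewrite mulrDl; move: d1 d2 d3; set q := L * B.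
have -> : q / 2 * norm2 w = q * norm2 w / 2 by rewrite mulrAC.
by lra.
Qed.

Definition accel_bound B : R := 2 * L * speed_bound B ^+ 2 / c1.

Lemma accel_bound_ge0 B : 0 <= accel_bound B.
Proof.
by rewrite divr_ge0 ?(ltW c1_gt0)// mulr_ge0 ?sqr_ge0// mulr_ge0.
Qed.

(** Tested on itself, the velocity difference splits into a momentum jump, at most [L K^2 / (2 N)],
    and a change of midpoint under a fixed velocity, at most [L K^2 / N]. Their sum is rounded up to
    the [2] in [accel_bound]. *)
Lemma vel_step N x n B : 0 <= B -> (n.+1 < N)%N -> disc_critical N x ->
  Edisc N x <= c1 * B ->
  norm2 (vel N x n.+1 - vel N x n) <= accel_bound B / N%:R.
Proof.
move=> B0 nN crit EB; have N0 : (0 < N)%N by case: N nN {crit EB}.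
have N0' : 0 < N%:R :> R by rewrite ltr0n.
set K := speed_bound B; have K0 : 0 <= K by exact: speed_bound_ge0.
set d := vel N x n.+1 - vel N x n.
have b1 : norm2 (vel N x n.+1) <= K by exact: vel_le.
have b0 : norm2 (vel N x n) <= K by apply: vel_le => //; exact: ltnW.
have -> : accel_bound B / N%:R = (2 * L * K ^+ 2 / N%:R) / c1.
  by rewrite /accel_bound -/K mulrAC.
apply: ler_sqr_of_mul => //; first by rewrite divr_ge0// mulr_ge0 ?sqr_ge0// mulr_ge0.
apply: le_trans (ellH (mid x n.+1) d).1 _.
have e1 : gmet H (mid x n.+1) d d =
    (gmet H (mid x n.+1) (vel N x n.+1) d - gmet H (mid x n) (vel N x n) d) +
    (gmet H (mid x n) (vel N x n) d - gmet H (mid x n.+1) (vel N x n) d).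
  by rewrite {1}/d gmetDl gmetNl; ring.
rewrite e1.
have h1 : gmet H (mid x n.+1) (vel N x n.+1) d - gmet H (mid x n) (vel N x n) d
    <= L * K ^+ 2 / N%:R * norm2 d / 2.
  apply: le_trans (ler_norm _) _; apply: le_trans (momentum_step d nN crit) _.
  have -> : L * K ^+ 2 / N%:R * norm2 d / 2 =
    L / (4 * N%:R) * norm2 d * (K ^+ 2 + K ^+ 2) by field; rewrite gt_eqF.
  rewrite ler_wpM2l//.
    by rewrite !mulr_ge0 ?norm2_ge0 ?invr_ge0 ?mulr_ge0.
  by apply: lerD; rewrite ler_sqr ?nnegrE ?norm2_ge0.
have h2 : gmet H (mid x n) (vel N x n) d - gmet H (mid x n.+1) (vel N x n) d
    <= L * K ^+ 2 / N%:R * norm2 d.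
  apply: le_trans (ler_norm _) _; apply: le_trans (gmet_lip _ _ _ _ lipH) _.
  rewrite ler_wpM2r ?norm2_ge0//.
  have -> : L * K ^+ 2 / N%:R = L * (K / N%:R) * K by field; rewrite gt_eqF.
  apply: ler_pM => //; rewrite ?norm2_ge0 ?mulr_ge0 ?norm2_ge0//.
  rewrite ler_wpM2l//.
  have -> : mid x n - mid x n.+1 = (- (2 * N%:R)^-1) *: (vel N x n + vel N x n.+1).
    by apply/rowP => j; rewrite !mxE; field; rewrite gt_eqF.
  rewrite norm2Z normrN ger0_norm ?invr_ge0 ?mulr_ge0 ?(ltW N0')//.
  have -> : K / N%:R = (2 * N%:R)^-1 * (K + K) by field; rewrite gt_eqF.
  rewrite ler_wpM2l ?invr_ge0 ?mulr_ge0 ?(ltW N0')//.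
  by apply: le_trans (norm2D _ _) _; exact: lerD.
apply: le_trans (lerD h1 h2) _.
have -> : 2 * L * K ^+ 2 / N%:R * norm2 d = 2 * (L * K ^+ 2 / N%:R * norm2 d) by ring.
have : 0 <= L * K ^+ 2 / N%:R * norm2 d.
  by rewrite mulr_ge0 ?norm2_ge0// divr_ge0// mulr_ge0 ?sqr_ge0.
by lra.
Qed.

(* [vel] is frozen after its last index [N.-1], so that it is defined at the
   right endpoint of the grid. *)
Definition velx N x n : V := vel N x (minn n N.-1).

Lemma velx_le N x n B : 0 <= B -> (0 < N)%N -> disc_critical N x ->
  Edisc N x <= c1 * B -> norm2 (velx N x n) <= speed_bound B.
Proof.
move=> B0 N0 crit EB; apply: vel_le => //.
by rewrite -[X in (_ < X)%N](prednK N0) ltnS geq_minr.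
Qed.

Lemma velx_dist N x i d B : 0 <= B -> (0 < N)%N -> disc_critical N x ->
  Edisc N x <= c1 * B ->
  norm2 (velx N x (i + d) - velx N x i) <= accel_bound B * (d%:R / N%:R).
Proof.
move=> B0 N0 crit EB; elim: d => [|d IH].
  by rewrite addn0 subrr norm2_0 mul0r mulr0.
apply: le_trans (norm2_distD (velx N x (i + d)) _ _) _.
rewrite -natr1 mulrDl mulrDr [leRHS]addrC; apply: lerD => //.
rewrite addnS /velx; have [le|lt] := leqP N.-1 (i + d).
  rewrite (minn_idPr (leqW le)) subrr norm2_0.
  by rewrite mulr_ge0 ?accel_bound_ge0 ?divr_ge0.
rewrite (minn_idPl lt) mul1r; apply: vel_step => //.
by rewrite -[X in (_ < X)%N](prednK N0) ltnS.
Qed.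

Lemma node_diff N x n : (n < N)%N -> x n.+1 - x n = N%:R^-1 *: velx N x n.
Proof.
move=> nN; have N0 : (0 < N)%N by case: N nN.
rewrite /velx (minn_idPl _); last by rewrite -ltnS prednK.
by rewrite scalerA mulVf ?scale1r// pnatr_eq0 -lt0n.
Qed.

Lemma node_dist N x i d B : 0 <= B -> (0 < N)%N -> disc_critical N x ->
  Edisc N x <= c1 * B -> (i + d <= N)%N ->
  norm2 (x (i + d)%N - x i) <= speed_bound B * (d%:R / N%:R).
Proof.
move=> B0 N0 crit EB; elim: d => [|d IH] idN.
  by rewrite addn0 subrr norm2_0 mul0r mulr0.
apply: le_trans (norm2_distD (x (i + d)%N) _ _) _.
rewrite -natr1 mulrDl mulrDr [leRHS]addrC; rewrite addnS in idN *.
apply: lerD; last exact/IH/ltnW.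
rewrite (node_diff x idN) norm2Z ger0_norm ?invr_ge0// mul1r mulrC.
by rewrite ler_wpM2r ?invr_ge0//; exact: velx_le.
Qed.

(** Discrete Taylor formula: cell [i + k] adds [1 / N] times a velocity drift of order [k / N], and
    the sum of all [k < d] is at most [d ^ 2]. *)
Lemma node_taylor N x i d B : 0 <= B -> (0 < N)%N -> disc_critical N x ->
  Edisc N x <= c1 * B -> (i + d <= N)%N ->
  norm2 (x (i + d)%N - x i - (d%:R / N%:R) *: velx N x i) <=
  accel_bound B * (d%:R / N%:R) ^+ 2.
Proof.
move=> B0 N0 crit EB; have N0' : 0 < N%:R :> R by rewrite ltr0n.
elim: d => [|d IH] idN.
  by rewrite addn0 mul0r scale0r subrr subr0 norm2_0 expr0n mulr0.
rewrite addnS in idN *.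
have -> : x (i + d).+1 - x i - (d.+1%:R / N%:R) *: velx N x i =
    (x (i + d)%N - x i - (d%:R / N%:R) *: velx N x i) +
    N%:R^-1 *: (velx N x (i + d) - velx N x i).
  rewrite -natr1 mulrDl scalerDl mul1r scalerBr -(node_diff x idN).
  move: (x (i + d)%N) (x i) (x (i + d).+1) (_ *: _) (_ *: _) => a b c e f.
  by apply/rowP => j; rewrite !mxE; ring.
apply: le_trans (norm2D _ _) _; rewrite norm2Z ger0_norm ?invr_ge0//.
have h := ler_wpM2l (ltW (_ : 0 < N%:R^-1 :> R)) (velx_dist i d B0 N0 crit EB).
rewrite invr_gt0 in h.
apply: le_trans (lerD (IH (ltnW idN)) (h N0')) _.
rewrite -natr1.
have -> : N%:R^-1 * (accel_bound B * (d%:R / N%:R)) =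
   accel_bound B * (N%:R^-1 * (d%:R / N%:R)) by ring.
rewrite -mulrDr ler_wpM2l ?accel_bound_ge0//.
have -> : ((d%:R + 1) / N%:R) ^+ 2 = (d%:R / N%:R) ^+ 2 + N%:R^-1 * (d%:R / N%:R)
   + N%:R^-1 * (d%:R / N%:R) + (N%:R^-1) ^+ 2 :> R by ring.
have : 0 <= N%:R^-1 * (d%:R / N%:R) :> R by rewrite mulr_ge0 ?divr_ge0 ?invr_ge0.
have : 0 <= N%:R^-1 ^+ 2 :> R by exact: sqr_ge0.
by lra.
Qed.

End Discrete.

(** * Monotonicity, limits and derivatives *)

(** The interval is split at each exceptional point. Applied to differences of primitives, this
    takes the place of comparing integrals. *)
Lemma nondecreasing_off_finite (R : realType) (f : R -> R) (a b : R) (S : seq R) :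
  a <= b -> {within `[a, b], continuous f} ->
  (forall t, a < t -> t < b -> t \notin S -> derivable f t 1 /\ 0 <= derive1 f t) ->
  f a <= f b.
Proof.
elim: S a b => [|c S IH] a b ab cf df.
  have d1 t : t \in `]a, b[%R -> derivable f t 1.
    by rewrite in_itv/= => /andP[at_ tb]; have [] := df _ at_ tb isT.
  have d2 t : t \in `]a, b[%R -> 0 <= derive1 f t.
    by rewrite in_itv/= => /andP[at_ tb]; have [] := df _ at_ tb isT.
  by apply: (ger0_derive1_le_cc d1 d2 cf); rewrite ?in_itv/= ?lexx ?ab.
have [/andP[ac cb]|cab] := boolP ((a < c) && (c < b)).
  apply: (@le_trans _ _ (f c)).
    apply: IH; first exact: ltW.
      apply: continuous_subspaceW cf; apply: subset_itvl; rewrite bnd_simp; exact: ltW.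
    move=> t at_ tc tS; apply: df => //; first exact: lt_trans cb.
    by rewrite inE negb_or lt_eqF.
  apply: IH; first exact: ltW.
    apply: continuous_subspaceW cf; apply: subset_itvr; rewrite bnd_simp; exact: ltW.
  move=> t ct tb tS; apply: df => //; first exact: lt_trans ct.
  by rewrite inE negb_or gt_eqF.
apply: IH => // t at_ tb tS; apply: df => //; rewrite inE negb_or tS andbT.
by apply: contraNneq cab => <-; rewrite at_.
Qed.

Lemma cvg_bigsum (R : realType) (T I : Type) (F : set_system T) {FF : Filter F}
    (r : seq I) (f : I -> T -> R) (l : I -> R) :
  (forall i, f i t @[t --> F] --> l i) ->
  (\sum_(i <- r) f i t) @[t --> F] --> \sum_(i <- r) l i.
Proof.
move=> fl; elim: r => [|i r IH].
  rewrite big_nil; under eq_fun do rewrite big_nil; exact: cvg_cst.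
rewrite big_cons; under eq_fun do rewrite big_cons.
by apply: cvgD => //; exact: fl.
Qed.

Lemma is_derive_mull (R : realType) (c t : R) : is_derive t 1 (fun r => c * r) c.
Proof.
have := is_deriveZ c (is_derive_id t (1 : R)).
by rewrite [_ *: 1]mulr1.
Qed.

Section GmetContinuity.
Variables (R : realType) (D : nat).
Notation V := 'rV[R]_D.
Variables (H : V -> 'M[R]_D).
Hypothesis contH : forall i j, continuous (fun x => H x i j).

Lemma gmet_cvg (T : Type) (F : set_system T) {FF : Filter F} (x u v : T -> V) x0 u0 v0 :
  x t @[t --> F] --> x0 -> u t @[t --> F] --> u0 -> v t @[t --> F] --> v0 ->
  gmet H (x t) (u t) (v t) @[t --> F] --> gmet H x0 u0 v0.
Proof.
move=> cx cu cv; rewrite gmetE; under eq_fun do rewrite gmetE.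
apply: cvg_bigsum => i; apply: cvg_bigsum => j.
apply: cvgM; last exact: (cvg_comp _ _ cv (@coord_continuous _ _ _ 0 j v0)).
apply: cvgM; first exact: (cvg_comp _ _ cu (@coord_continuous _ _ _ 0 i u0)).
exact: (cvg_comp _ _ cx (@contH i j x0)).
Qed.

Lemma is_derive_gmet x w (s : R -> V) t : derivable s t 1 ->
  is_derive t 1 (fun r => gmet H x w (s r)) (gmet H x w (derive1 s t)).
Proof.
move=> ds; have c : (h^-1 *: (gmet H x w (s (h *: 1 + t)) - gmet H x w (s t))) @[h --> 0^']
    --> gmet H x w (derive1 s t).
  have -> : (fun h : R => h^-1 *: (gmet H x w (s (h *: 1 + t)) - gmet H x w (s t))) =
    (fun h : R => gmet H x w (h^-1 *: (s (h *: 1 + t) - s t))).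
    by apply/funext => h; rewrite gmetZr gmetDr gmetNr.
  apply: gmet_cvg; [exact: cvg_cst|exact: cvg_cst|rewrite derive1E; exact: ds].
split; first by apply/cvg_ex; exists (gmet H x w (derive1 s t)).
exact/cvg_lim.
Qed.

End GmetContinuity.

(** * Energy of a piecewise [C^1] curve against the energy of a discrete one *)

Section Curves.
Variables (R : realType) (D : nat).
Notation V := 'rV[R]_D.
Variables (H : V -> 'M[R]_D).
Hypothesis contH : forall i j, continuous (fun x => H x i j).

(** What the comparisons need of a piecewise [C^1] curve. At the break points, listed in [S],
    [derive1] may take any value. *)
Definition regular_off (S : seq R) (K : R) (s : R -> V) :=
  [/\ 0 <= K, {within `[0, 1], continuous s} &
  forall t, 0 < t -> t < 1 -> t \notin S ->
    [/\ derivable s t 1, {for t, continuous (derive1 s)} & norm2 (derive1 s t) <= K]].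

Lemma C1curve_bounded (phi : R -> V) (a b : R) : C1curve phi -> a <= b ->
  exists K, forall t, a <= t -> t <= b -> norm2 (derive1 phi t) <= K.
Proof.
move=> [_ cphi] ab.
have cn : {within `[a, b], continuous (fun t => `|derive1 phi t|)}.
  apply: continuous_subspaceT => t; apply: continuous_comp; first exact: cphi.
  exact: norm_continuous.
have [c _ hc] := EVT_max ab cn.
exists (D%:R * `|derive1 phi c|) => t at_ tb.
apply: le_trans (norm2_le_mx_norm _) _; apply: ler_wpM2l; first exact: ler0n.
by apply: hc; rewrite in_itv/= at_.
Qed.

Lemma partition_piece (s : nat -> R) k t : s 0%N <= t -> t < s k ->
  exists2 i, (i < k)%N & s i <= t < s i.+1.
Proof.
elim: k => [|k IH] s0 sk; first by move: (le_lt_trans s0 sk); rewrite ltxx.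
have [h|h] := ltP t (s k); last by exists k => //; rewrite h.
by have [i ik hi] := IH s0 h; exists i => //; exact: leqW.
Qed.

(** Inside an open piece the curve agrees near each point with a [C^1] map, so derivatives transfer;
    [K] is a maximum over the pieces. *)
Lemma pcurve_regular (s : R -> V) : pcurve s -> exists S K, regular_off S K s.
Proof.
move=> [cs [k [p [p0 [pk [pinc hp]]]]]].
have [K [K0 hK]] : exists K, 0 <= K /\ forall i, (i < k)%N -> exists phi, [/\ C1curve phi,
    forall t, p i <= t <= p i.+1 -> s t = phi t &
    forall t, p i <= t -> t <= p i.+1 -> norm2 (derive1 phi t) <= K].
  move: {pk} k pinc hp; elim=> [|k IH] pinc hp; first by exists 0.
  have [|i ik|K [K0 hK]] := IH; first by move=> i ik; apply/pinc/leqW.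
    by apply/hp/leqW.
  have [phi [cphi hphi]] := hp k (ltnSn k).
  have [K' hK'] := C1curve_bounded cphi (ltW (pinc k (ltnSn k))).
  exists (Num.max K K'); split; first by rewrite le_max K0.
  move=> i; rewrite ltnS leq_eqVlt => /predU1P[->|/hK[psi [h1 h2 h3]]].
    by exists phi; split => // t t1 t2; rewrite le_max hK' ?orbT.
  by exists psi; split => // t t1 t2; rewrite le_max h3.
exists [seq p i | i <- iota 0 k.+1], K; split => // t t0 t1 tS.
have [i ik /andP[pit tpi]] : exists2 i, (i < k)%N & p i <= t < p i.+1.
  by apply: partition_piece; rewrite ?p0 ?pk// ltW.
have {}pit : p i < t.
  rewrite lt_neqAle pit andbT; apply: contraNneq tS => <-.
  by apply: map_f; rewrite mem_iota/= add0n ltnS ltnW.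
have [phi [[dphi cphi] h2 h3]] := hK i ik.
have tin r : r \in `]p i, p i.+1[%R -> \near r, phi r = s r.
  move=> rin; near=> z; rewrite h2//.
  have : z \in `]p i, p i.+1[%R by near: z; exact: near_in_itvoo.
  by rewrite in_itv/= => /andP[? ?]; rewrite !ltW.
have tin' : t \in `]p i, p i.+1[%R by rewrite in_itv/= pit.
have e r : r \in `]p i, p i.+1[%R -> derive1 s r = derive1 phi r.
  by move=> rin; rewrite !derive1E; apply/esym/near_eq_derive/tin.
split.
- by apply: near_eq_derivable (dphi t); exact: tin.
- suff : derive1 s r @[r --> t] --> derive1 s t by [].
  rewrite (e t tin'); apply: cvg_trans (cphi t); apply: near_eq_cvg.
  by near=> z; apply/esym/e; near: z; exact: near_in_itvoo.
- by rewrite e// h3// ltW.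
Unshelve. all: by end_near. Qed.


Variables (c1 c2 L : R).
Hypothesis symH : forall x, (H x)^T = H x.
Hypothesis c1_gt0 : 0 < c1.
Hypothesis c2_gt0 : 0 < c2.
Hypothesis ellH : forall x u,
  c1 * norm2 u ^+ 2 <= gmet H x u u /\ gmet H x u u <= c2 * norm2 u ^+ 2.
Hypothesis L_ge0 : 0 <= L.
Hypothesis lipH : forall x y, opnorm (H x - H y) <= L * norm2 (x - y).

Lemma measurable_fun_seq (S : seq R) (f : R -> R) :
  measurable [set` S] /\ measurable_fun [set` S] f.
Proof.
elim: S => [|a S [mS mf]]; first by rewrite set_nil; split => //; exact: measurable_fun_set0.
have -> : [set` a :: S] = [set a] `|` [set` S].
  apply/seteqP; split => t /=; rewrite inE; first by move=> /predU1P.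
  by move=> [->|->]; rewrite ?eqxx ?orbT.
split; first exact: measurableU.
by apply/measurable_funU => //; split => //; exact: measurable_fun_set1.
Qed.

(** [f] is continuous and bounded on the open set [U]; the finitely many other points, endpoints
    included, spoil neither measurability nor boundedness. *)
Lemma continuous_off_finite_integrable (f : R -> R) (S : seq R) (M : R) :
  (forall t, 0 < t -> t < 1 -> t \notin S -> {for t, continuous f} /\ `|f t| <= M) ->
  (@lebesgue_measure R).-integrable `[0, 1] (EFin \o f).
Proof.
move=> hf; pose S' := [:: 0, 1 & S].
pose U : set R := `]0, 1[%classic `\` [set` S'].
have oU : open U.
  rewrite /U setDE; apply: openI; first exact: interval_open.
  apply: closed_openC.
  apply: (accessible_finite_set_closed.1 _ _ (finite_seq _)).
  exact/hausdorff_accessible/Rhausdorff.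
have inU t : U t -> [/\ 0 < t, t < 1 & t \notin S].
  move=> [/=]; rewrite in_itv/= => /andP[t0 t1] /negP; rewrite !inE !negb_or.
  by move=> /and3P[].
have cover : `[0, 1]%classic `<=` U `|` [set` S'].
  move=> t /=; rewrite in_itv/= => /andP[t0 t1].
  have [tS|tS] := boolP (t \in S'); [by right|left; split; last exact/negP].
  move: tS; rewrite !inE !negb_or => /and3P[n0 n1 _] /=.
  by rewrite in_itv/= !lt_neqAle t0 t1 eq_sym n0 n1.
have mU : measurable_fun U f.
  apply: open_continuous_measurable_fun => // t; rewrite inE => /inU[t0 t1 tS].
  by have [] := hf t t0 t1 tS.
have [mS mfS] := measurable_fun_seq S' f.
have mUS : measurable_fun (U `|` [set` S']) f.
  by apply/measurable_funU => //; exact: open_measurable.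
apply: measurable_bounded_integrable => //.
- by rewrite /= lebesgue_measure_itv/= lte_fin ltr01 ltry.
- apply: measurable_funS mUS => //; apply: measurableU => //; exact: open_measurable.
pose B := `|M| + \sum_(r <- S') `|f r|.
have s0 : 0 <= \sum_(r <- S') `|f r| by rewrite sumr_ge0.
exists B; split; first exact: num_real.
move=> y By t /cover [/inU[t0 t1 tS]|/= tS].
  have [_ h] := hf t t0 t1 tS; apply: le_trans h _; apply: le_trans (ltW By).
  by apply: le_trans (ler_norm M) _; rewrite /B lerDl.
apply: le_trans (ltW By); rewrite /B (big_rem t)//= addrCA lerDl addr_ge0//.
by rewrite sumr_ge0.
Qed.

(** Integration ends here: later estimates see the energy only as the increment of a continuous [P]
    with known derivative off [S]. *)
Lemma energy_primitive S K (s : R -> V) : regular_off S K s ->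
  exists P : R -> R, [/\ {within `[0, 1], continuous P},
    (forall t, 0 < t -> t < 1 -> t \notin S ->
      is_derive t 1 P (gmet H (s t) (derive1 s t) (derive1 s t))) &
    energy H s = P 1 - P 0].
Proof.
move=> [K0 cs hs]; pose f t := gmet H (s t) (derive1 s t) (derive1 s t).
have cf t : 0 < t -> t < 1 -> t \notin S -> {for t, continuous f}.
  move=> t0 t1 tS; have [ds cds _] := hs t t0 t1 tS.
  have cst : {for t, continuous s}.
    by apply: (within_continuous_continuous ltr01 cs); rewrite in_itv/= t0.
  exact: (gmet_cvg contH cst cds cds).
have intf : (@lebesgue_measure R).-integrable `[0, 1] (EFin \o f).
  apply: (@continuous_off_finite_integrable _ S (c2 * K ^+ 2)) => t t0 t1 tS.
  split; first exact: cf.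
  have [_ _ hK] := hs t t0 t1 tS; rewrite ger0_norm; last exact: (gmet_ge0 c1_gt0 ellH).
  apply: le_trans (ellH _ _).2 _; rewrite ler_wpM2l ?(ltW c2_gt0)//.
  have n0 := norm2_ge0 (derive1 s t).
  by rewrite ler_sqr ?nnegrE// (le_trans n0).
pose P x := Rintegral (@lebesgue_measure R) `[0, x] f.
exists P; split.
- exact: (parameterized_integral_continuous ler01 intf).
- move=> t t0 t1 tS.
  have [dP eP] := continuous_FTC1_closed t1 intf t0 (cf t t0 t1 tS).
  by apply: DeriveDef; [exact: dP|rewrite -derive1E; exact: eP].
- by rewrite /P set_itv1 Rintegral_set1 subr0.
Qed.

(** Vector mean value inequality, reduced to a scalar one by taking the component of [s] along the
    chord [w]. *)
Lemma regular_lipschitz S K (s : R -> V) a b : regular_off S K s ->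
  0 <= a -> a <= b -> b <= 1 -> norm2 (s b - s a) <= K * (b - a).
Proof.
move=> [K0 cs hs] a0 ab b1; set w := s b - s a.
have c1M (i j : 'I_D) : continuous (fun _ : V => (1%:M : 'M[R]_D) i j).
  by move=> z; exact: cst_continuous.
pose f t := K * norm2 w * t - gmet (fun=> 1%:M) 0 w (s t).
have fab : f a <= f b.
  apply: (@nondecreasing_off_finite _ _ _ _ S) => //.
    suff cf : {within `[0, 1], continuous f}.
      by apply: continuous_subspaceW cf; apply: subset_itv; rewrite bnd_simp.
    have ci : {within `[0, 1], continuous (fun t : R => t)}.
      by apply: continuous_subspaceT => ?; exact: cvg_id.
    move=> t; apply: cvgB; first by apply: cvgM; [exact: cvg_cst|exact: ci].
    by apply: (gmet_cvg c1M); [exact: cvg_cst|exact: cvg_cst|exact: cs].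
  move=> t at_ tb tS.
  have [ds _ nK] := hs t (le_lt_trans a0 at_) (lt_le_trans tb b1) tS.
  have df : is_derive t 1 f (K * norm2 w - gmet (fun=> 1%:M) 0 w (derive1 s t)).
    apply: is_deriveB.
      exact: is_derive_mull.
    exact: is_derive_gmet.
  split; first exact: ex_derive.
  rewrite derive1E derive_val subr_ge0.
  apply: le_trans (ler_norm _) _; apply: le_trans (ip_le _ _) _.
  by rewrite mulrC ler_wpM2r ?norm2_ge0.
have ww : gmet (fun=> 1%:M) 0 w (s b) - gmet (fun=> 1%:M) 0 w (s a) = norm2 w ^+ 2.
  by rewrite -gmetNr -gmetDr -ipxx.
rewrite -[leRHS]divr1; apply: ler_sqr_of_mul => //.
  by rewrite mulr_ge0// subr_ge0.
rewrite mul1r -ww; move: fab; rewrite /f.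
have -> : K * (b - a) * norm2 w = K * norm2 w * b - K * norm2 w * a by ring.
by lra.
Qed.

(** The convex quadratic form lies above its tangent at [w]. *)
Lemma gmet_tangent_ge0 z u w :
  0 <= gmet H z u u - 2 * gmet H z w u + gmet H z w w.
Proof.
have := gmet_ge0 c1_gt0 ellH z (u - w).
by rewrite !gmet_lin (gmetC (x := z) u w)//; lra.
Qed.

(* By convexity of [gmet H m], a cell of the sampled curve costs at most
   [2 gmet H m w (s' t) - gmet H m w w] integrated over the cell. *)
Lemma Edisc_sample_le S K (s : R -> V) N : (0 < N)%N -> regular_off S K s ->
  Edisc H N (fun n => s (n%:R / N%:R)) <= energy H s + L * K ^+ 3 / N%:R.
Proof.
move=> N0 rs; have N0' : 0 < N%:R :> R by rewrite ltr0n.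
have [P [cP dP ->]] := energy_primitive rs.
have [K0 cs hs] := rs.
set x := fun n => _; set e := L * K ^+ 3 / N%:R.
have t0 n : 0 <= n%:R / N%:R :> R by rewrite divr_ge0.
have t1 n : (n <= N)%N -> n%:R / N%:R <= 1 :> R by move=> nN; rewrite ler_pdivrMr// mul1r ler_nat.
have tS n : n.+1%:R / N%:R = n%:R / N%:R + N%:R^-1 :> R by rewrite -natr1 mulrDl mul1r.
have cell n : (n < N)%N -> N%:R^-1 * gmet H (mid x n) (vel N x n) (vel N x n) <=
    P (n.+1%:R / N%:R) - P (n%:R / N%:R) + N%:R^-1 * e.
  move=> nN; set m := mid x n; set w := vel N x n.
  set a := n%:R / N%:R; set b := n.+1%:R / N%:R.
  have ab : a <= b by rewrite /b tS lerDl invr_ge0.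
  have a0 : 0 <= a by exact: t0.
  have b1 : b <= 1 by exact: t1.
  have bE : b = a + N%:R^-1 by exact: tS.
  (* The derivative of [f] is nonnegative by the tangent inequality, [e] paying for the change of
     base point. As [w] is the mean velocity of the cell, the increment of [f] is exactly the
     claimed difference. *)
  pose f t := P t - 2 * gmet H m w (s t) + (gmet H m w w + e) * t.
  have fab : f a <= f b.
    apply: (@nondecreasing_off_finite _ _ _ _ S) => //.
      suff cf : {within `[0, 1], continuous f}.
        by apply: continuous_subspaceW cf; apply: subset_itv; rewrite bnd_simp.
      have ci : {within `[0, 1], continuous (fun t : R => t)}.
        by apply: continuous_subspaceT => ?; exact: cvg_id.
      move=> t; apply: cvgD; last by apply: cvgM; [exact: cvg_cst|exact: ci].
      apply: cvgB; first exact: cP.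
      apply: cvgM; first exact: cvg_cst.
      by apply: (gmet_cvg contH); [exact: cvg_cst|exact: cvg_cst|exact: cs].
    move=> t at_ tb tnS.
    have tp := le_lt_trans a0 at_; have t_lt1 := lt_le_trans tb b1.
    have [ds _ nK] := hs t tp t_lt1 tnS.
    set u := derive1 s t in nK.
    have df : is_derive t 1 f (gmet H (s t) u u - 2 * gmet H m w u + (gmet H m w w + e)).
      apply: is_deriveD; last exact: is_derive_mull.
      apply: is_deriveB; first exact: dP.
      exact: (is_deriveZ 2 (is_derive_gmet contH m w ds)).
    split; first exact: ex_derive.
    rewrite derive1E derive_val.
    have dist : norm2 (m - s t) <= K / N%:R.
      (* The midpoint averages the two end nodes, whose distances to [s t] add up to at most
         [K / N]. *)
      have -> : m - s t = 2^-1 *: ((s b - s t) - (s t - s a)).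
        rewrite /m /mid /x -/a -/b.
        by apply/rowP => j; rewrite !mxE; field.
      rewrite norm2Z ger0_norm ?invr_ge0//.
      have h1 := regular_lipschitz rs (ltW tp) (ltW tb) b1.
      have h2 := regular_lipschitz rs a0 (ltW at_) (ltW t_lt1).
      have h3 := norm2D (s b - s t) (- (s t - s a)); rewrite norm2N in h3.
      have h4 : K * (b - t) + K * (t - a) = K / N%:R by rewrite -mulrDr bE; ring.
      have : 0 <= K / N%:R by rewrite divr_ge0.
      by rewrite ler_pdivrMl//; lra.
    have cmp : gmet H m u u - gmet H (s t) u u <= e.
      apply: le_trans (ler_norm _) _; apply: le_trans (gmet_lip _ _ _ _ lipH) _.
      have -> : e = L * (K / N%:R) * K * K by rewrite /e; field; rewrite gt_eqF.
      have nu := norm2_ge0 u; have nd := norm2_ge0 (m - s t).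
      by do 2! (apply: ler_pM => //; rewrite ?mulr_ge0//); rewrite ler_wpM2l.
    by have := gmet_tangent_ge0 m u w; move: cmp; lra.
  have lin : gmet H m w (s b) - gmet H m w (s a) = N%:R^-1 * gmet H m w w.
    rewrite -gmetNr -gmetDr -gmetZr; congr (gmet H m w _).
    by rewrite /w /vel scalerA mulVf ?scale1r// gt_eqF.
  move: fab lin; rewrite /f.
  have -> : (gmet H m w w + e) * b = (gmet H m w w + e) * a + N%:R^-1 * gmet H m w w + N%:R^-1 * e.
    by rewrite bE; ring.
  by move: (gmet H m w (s b)) (gmet H m w (s a)) (P a) (P b) => *; lra.
rewrite /Edisc mulr_sumr.
apply: (@le_trans _ _ (\sum_(n < N) (P (n.+1%:R / N%:R) - P (n%:R / N%:R) + N%:R^-1 * e))).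
  by apply: ler_sum => n _; exact: cell.
rewrite big_split/= sumr_const card_ord -(big_mkord xpredT (fun n => P (n.+1%:R / N%:R) - P (n%:R / N%:R))).
rewrite telescope_sumr// divff ?gt_eqF// mul0r lerD2l.
by rewrite -mulrnAl -mulr_natl divff ?gt_eqF// mul1r.
Qed.

(** Serves both the linear interpolation and the limit curve: a pointwise bound in each cell, off
    [S], integrates to the discrete sum. *)
Lemma energy_le_Edisc S K (s : R -> V) N (x : nat -> V) e : (0 < N)%N -> regular_off S K s ->
  (forall n t, (n < N)%N -> n%:R / N%:R < t -> t < n.+1%:R / N%:R -> t \notin S ->
    gmet H (s t) (derive1 s t) (derive1 s t) <=
    gmet H (mid x n) (vel N x n) (vel N x n) + e) ->
  energy H s <= Edisc H N x + e.
Proof.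
move=> N0 rs hx; have N0' : 0 < N%:R :> R by rewrite ltr0n.
have [P [cP dP ->]] := energy_primitive rs.
have tS n : n.+1%:R / N%:R = n%:R / N%:R + N%:R^-1 :> R by rewrite -natr1 mulrDl mul1r.
have cell n : (n < N)%N -> P (n.+1%:R / N%:R) - P (n%:R / N%:R) <=
    N%:R^-1 * gmet H (mid x n) (vel N x n) (vel N x n) + N%:R^-1 * e.
  move=> nN; set a := n%:R / N%:R; set b := n.+1%:R / N%:R.
  set g := gmet _ _ _ _.
  have bE : b = a + N%:R^-1 by exact: tS.
  have ab : a <= b by rewrite bE lerDl invr_ge0.
  have a0 : 0 <= a by rewrite divr_ge0.
  have b1 : b <= 1 by rewrite ler_pdivrMr// mul1r ler_nat.
  pose f t := (g + e) * t - P t.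
  have : f a <= f b.
    apply: (@nondecreasing_off_finite _ _ _ _ S) => //.
      suff cf : {within `[0, 1], continuous f}.
        by apply: continuous_subspaceW cf; apply: subset_itv; rewrite bnd_simp.
      have ci : {within `[0, 1], continuous (fun t : R => t)}.
        by apply: continuous_subspaceT => ?; exact: cvg_id.
      move=> t; apply: cvgB; first by apply: cvgM; [exact: cvg_cst|exact: ci].
      exact: cP.
    move=> t at_ tb tnS.
    have df : is_derive t 1 f (g + e - gmet H (s t) (derive1 s t) (derive1 s t)).
      apply: is_deriveB; first exact: is_derive_mull.
      by apply: dP => //; [exact: le_lt_trans at_|exact: lt_le_trans b1].
    split; first exact: ex_derive.
    by rewrite derive1E derive_val subr_ge0; exact: hx.
  rewrite /f [in X in _ <= X -> _]bE => h.
  have : (g + e) * (a + N%:R^-1) = (g + e) * a + N%:R^-1 * g + N%:R^-1 * e by ring.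
  by move: h; rewrite -bE; lra.
rewrite /Edisc mulr_sumr.
have -> : P 1 - P 0 = \sum_(n < N) (P (n.+1%:R / N%:R) - P (n%:R / N%:R)).
  rewrite -(big_mkord xpredT (fun n => P (n.+1%:R / N%:R) - P (n%:R / N%:R))).
  by rewrite telescope_sumr// divff ?gt_eqF// mul0r.
apply: (@le_trans _ _ (\sum_(n < N)
    (N%:R^-1 * gmet H (mid x n) (vel N x n) (vel N x n) + N%:R^-1 * e))).
  by apply: ler_sum => n _; exact: cell.
rewrite big_split/= sumr_const card_ord lerD2l.
by rewrite -mulrnAl -mulr_natl divff ?gt_eqF// mul1r.
Qed.

End Curves.

(** * [C^1] regularity from a quadratic Taylor remainder *)

Lemma is_derive_of_taylor (R : realType) (D : nat) (f b : R -> 'rV[R]_D) (C : R) :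
  (forall s t, norm2 (f t - f s - (t - s) *: b s) <= C * (t - s) ^+ 2) ->
  forall s : R, is_derive s (1 : R) f (b s).
Proof.
move=> hf s.
have c : (h^-1 *: (f (h *: 1 + s) - f s)) @[h --> 0^'] --> b s.
  apply/cvgrPdist_le => e e0; near=> h.
  have h0 : h != 0 by near: h; exact: nbhs_dnbhs_neq.
  have hp : 0 < `|h| by rewrite normr_gt0.
  have C1 : 0 < `|C| + 1 by rewrite ltr_wpDl.
  have hs : `|h| <= e / (`|C| + 1).
    by apply: ltW; near: h; apply: dnbhs0_lt; rewrite divr_gt0.
  apply: le_trans (mx_norm_le_norm2 _) _.
  have hE : h *: 1 + s - s = h by rewrite addrK [LHS]mulr1.
  have := hf s (h *: 1 + s); rewrite hE.
  move: (f (h *: 1 + s) - f s) => X hX.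
  have -> : b s - h^-1 *: X = (- h^-1) *: (X - h *: b s).
    by rewrite scalerBr scalerA mulNr mulVf// scaleN1r opprK scaleNr addrC.
  rewrite norm2Z normrN normfV ler_pdivrMl//; apply: le_trans hX _.
  rewrite -real_normK ?num_real// expr2 mulrCA ler_pM2l//.
  apply: (@le_trans _ _ ((`|C| + 1) * `|h|)).
    by rewrite ler_pM2r// (le_trans (ler_norm C))// lerDl.
  by rewrite mulrC -ler_pdivlMr.
split; first by apply/cvg_ex; exists (b s).
exact/cvg_lim.
Unshelve. all: by end_near. Qed.

Lemma lipschitz_continuous (R : realType) (D : nat) (b : R -> 'rV[R]_D) (M : R) :
  (forall s t, norm2 (b t - b s) <= M * `|t - s|) -> continuous b.
Proof.
move=> hb s; apply/cvgrPdist_le => e e0; near=> t.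
have M1 : 0 < `|M| + 1 by rewrite ltr_wpDl.
apply: le_trans (mx_norm_le_norm2 _) _; apply: le_trans (hb _ _) _.
apply: (@le_trans _ _ ((`|M| + 1) * `|s - t|)).
  by rewrite ler_wpM2r// (le_trans (ler_norm M))// lerDl.
rewrite mulrC -ler_pdivlMr//.
by near: t; apply: cvgr_dist_le; [exact: cvg_id|rewrite divr_gt0].
Unshelve. all: by end_near. Qed.

Lemma C1curve_of_taylor (R : realType) (D : nat) (f b : R -> 'rV[R]_D) (C M : R) :
  (forall s t, norm2 (f t - f s - (t - s) *: b s) <= C * (t - s) ^+ 2) ->
  (forall s t, norm2 (b t - b s) <= M * `|t - s|) ->
  C1curve f /\ derive1 f = b.
Proof.
move=> hf hb; have df := is_derive_of_taylor hf.
have e : derive1 f = b by apply/funext => s; rewrite derive1E derive_val.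
split => //; split; first by move=> t; exact: ex_derive.
by rewrite e; exact: lipschitz_continuous hb.
Qed.

(** * Linear interpolation of a discrete curve *)

Section LinInterp.
Variables (R : realType) (D N : nat).
Notation V := 'rV[R]_D.
Variable gp : 'I_N.+1 -> V.
Hypothesis N_gt0 : (0 < N)%N.

(** Extends a grid curve to [nat]. Indices above [N] fall back to the first node and do not enter
    [Edisc H N]. *)
Definition nodes n : V := gp (inord n).

Lemma lin_interpE n t : (n < N)%N -> n%:R / N%:R <= t -> t <= n.+1%:R / N%:R ->
  lin_interp gp t = nodes n + (t - n%:R / N%:R) *: vel N nodes n.
Proof.
move=> nN t0 t1; have N0 : 0 < N%:R :> R by rewrite ltr0n.
have Nn0 : N%:R != 0 :> R by rewrite gt_eqF.
have nN1 : (n <= N.-1)%N by rewrite -ltnS prednK.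
have gen k : minn `|Num.floor (t * N%:R)|%N N.-1 = k ->
    lin_interp gp t = nodes k + (t - k%:R / N%:R) *: vel N nodes k.
  move=> h; rewrite /lin_interp h /vel scalerA [(_ - _) * N%:R]mulrC.
  rewrite scalerBr scalerBl scale1r -/(nodes k) -/(nodes k.+1).
  by rewrite -addrA; congr (_ + _); rewrite addrC.
have [tlt|tge] := ltP t (n.+1%:R / N%:R).
  apply: gen; have -> : Num.floor (t * N%:R) = n%:Z.
    apply: floor_def; rewrite -ler_pdivrMr// t0/=.
    rewrite (_ : (n%:Z + 1)%:~R = n.+1%:R) -?ltr_pdivlMr//.
    by rewrite rmorphD/= natr1.
  by rewrite absz_nat; exact/minn_idPl.
(* At the right end of a cell the floor already selects the next one, at offset zero, unless the cap
   [N.-1] keeps the last cell. *)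
have te : t = n.+1%:R / N%:R by apply/eqP; rewrite eq_le t1.
have fl : `|Num.floor (t * N%:R)|%N = n.+1.
  by rewrite te divfK// -[n.+1%:R]/((n.+1 : int)%:~R) intrKfloor absz_nat.
have [lt|ge] := leqP n.+1 N.-1; last first.
  apply: gen; rewrite fl; have -> : N.-1 = n by apply/eqP; rewrite eqn_leq nN1 -ltnS ge.
  exact/minn_idPr.
rewrite (gen n.+1); last by rewrite fl; exact/minn_idPl.
rewrite te subrr scale0r addr0 -natr1 mulrDl addrAC subrr add0r mul1r.
by rewrite /vel scalerA mulVf// scale1r addrC subrK.
Qed.

(** The affine piece on the whole line, because [C1curve] asks for a map defined everywhere. *)
Definition cell_curve n (t : R) : V := nodes n + (t - n%:R / N%:R) *: vel N nodes n.

Lemma cell_curve_C1 n : C1curve (cell_curve n) /\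
  derive1 (cell_curve n) = (fun=> vel N nodes n).
Proof.
apply: (@C1curve_of_taylor _ _ _ _ 0 0) => s t; last by rewrite subrr norm2_0 mul0r.
rewrite mul0r /cell_curve (_ : _ - _ = 0) ?norm2_0//.
by apply/rowP => j; rewrite !mxE; ring.
Qed.

Lemma lin_interp_within n : (n <= N)%N ->
  {within `[0, n%:R / N%:R], continuous (lin_interp gp)}.
Proof.
elim: n => [|n IH] nN; first by rewrite mul0r set_itv1; exact: continuous_subspace1.
have t0 k : 0 <= k%:R / N%:R :> R by rewrite divr_ge0.
have tn : n%:R / N%:R <= n.+1%:R / N%:R :> R by rewrite ler_wpM2r ?invr_ge0// ler_nat.
have -> : `[0, n.+1%:R / N%:R]%classic =
    (`[0, n%:R / N%:R] `|` `[n%:R / N%:R, n.+1%:R / N%:R])%classic :> set R.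
  apply/seteqP; split => t /=; rewrite !in_itv/=.
    move=> /andP[h0 h1]; have [h|h] := leP t (n%:R / N%:R).
      by left; rewrite h0.
    by right; rewrite ltW.
  by move=> [] /andP[h0 h1]; [rewrite h0 (le_trans h1)|rewrite h1 (le_trans (t0 n))].
apply: withinU_continuous; [exact: itv_closed|exact: itv_closed|exact/IH/ltnW|].
have cc : {within `[n%:R / N%:R, n.+1%:R / N%:R], continuous (cell_curve n)}.
  apply: derivable_within_continuous => t _.
  exact: (cell_curve_C1 n).1.1.
apply: subspace_eq_continuous cc => t; rewrite inE/= in_itv/= => /andP[h0 h1].
exact/esym/lin_interpE.
Qed.

Lemma lin_interp_pcurve : pcurve (lin_interp gp).
Proof.
have N0 : N%:R != 0 :> R by rewrite pnatr_eq0 -lt0n.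
split.
  by have := lin_interp_within (leqnn N); rewrite divff.
exists N, (fun n => n%:R / N%:R); split; first by rewrite mul0r.
split; first by rewrite divff.
split=> [i iN|i iN].
  by rewrite ltr_pM2r ?invr_gt0 ?ltr0n// ltr_nat.
exists (cell_curve i); split; first exact: (cell_curve_C1 i).1.
by move=> t /andP[h0 h1]; exact: lin_interpE.
Qed.

Lemma lin_interp0 : lin_interp gp 0 = gp ord0.
Proof.
rewrite (@lin_interpE 0)// ?mul0r// subrr scale0r addr0 /nodes.
by congr (gp _); apply/val_inj; rewrite /= inordK.
Qed.

Lemma lin_interp1 : lin_interp gp 1 = gp ord_max.
Proof.
have N0 : N%:R != 0 :> R by rewrite pnatr_eq0 -lt0n.
have NN : (N.-1.+1 = N)%N by rewrite prednK.
rewrite (@lin_interpE N.-1) ?NN ?leqnn ?divff//; last first.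
  by rewrite ler_pdivrMr ?ltr0n// mul1r ler_nat leq_pred.
rewrite /vel scalerA NN.
have -> : (1 - N.-1%:R / N%:R) * N%:R = 1 :> R.
  by rewrite mulrBl divfK// mul1r -[in X in X - _]NN -natr1 addrAC subrr add0r.
rewrite scale1r addrC subrK /nodes; congr (gp _); apply/val_inj.
by rewrite /= inordK.
Qed.

Lemma lin_interp_derive n t : (n < N)%N -> n%:R / N%:R < t -> t < n.+1%:R / N%:R ->
  derive1 (lin_interp gp) t = vel N nodes n.
Proof.
move=> nN t0 t1.
have -> : vel N nodes n = derive1 (cell_curve n) t by rewrite (cell_curve_C1 n).2.
rewrite !derive1E; apply: near_eq_derive; near=> z.
have : z \in `]n%:R / N%:R, n.+1%:R / N%:R[%R.
  by near: z; apply: near_in_itvoo; rewrite in_itv/= t0.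
by rewrite in_itv/= => /andP[h0 h1]; apply: lin_interpE => //; exact: ltW.
Unshelve. all: by end_near. Qed.

Section Energy.
Variables (H : V -> 'M[R]_D) (c1 c2 L K : R).
Hypothesis contH : forall i j, continuous (fun x => H x i j).
Hypothesis c1_gt0 : 0 < c1.
Hypothesis c2_gt0 : 0 < c2.
Hypothesis ellH : forall x u,
  c1 * norm2 u ^+ 2 <= gmet H x u u /\ gmet H x u u <= c2 * norm2 u ^+ 2.
Hypothesis L_ge0 : 0 <= L.
Hypothesis lipH : forall x y, opnorm (H x - H y) <= L * norm2 (x - y).

(** The velocity is constant on a cell, so the integrand differs from the midpoint value only
    through the base point, which is within [K / N] of the midpoint. *)
Lemma energy_lin_interp_le : (forall n, (n < N)%N -> norm2 (vel N nodes n) <= K) ->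
  energy H (lin_interp gp) <= Edisc H N nodes + L * K ^+ 3 / N%:R.
Proof.
move=> hK; have N0 : 0 < N%:R :> R by rewrite ltr0n.
have [S [K' rs]] := pcurve_regular lin_interp_pcurve.
apply: (energy_le_Edisc contH c1_gt0 c2_gt0 ellH N_gt0 rs) => n t nN t0 t1 _.
rewrite (lin_interp_derive nN t0 t1); set w := vel N nodes n.
have wK : norm2 w <= K by exact: hK.
have nw := norm2_ge0 w; have K0 := le_trans nw wK.
rewrite -lerBlDl; apply: le_trans (ler_norm _) _.
apply: le_trans (gmet_lip _ _ _ _ lipH) _.
have -> : L * K ^+ 3 / N%:R = L * (K / N%:R) * K * K by field; rewrite gt_eqF.
have dist : norm2 (lin_interp gp t - mid nodes n) <= K / N%:R.
  rewrite (lin_interpE nN (ltW t0) (ltW t1)).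
  have -> : nodes n + (t - n%:R / N%:R) *: vel N nodes n - mid nodes n =
      (t - n%:R / N%:R - (2 * N%:R)^-1) *: w.
    by apply/rowP => j; rewrite !mxE; field; rewrite gt_eqF.
  rewrite norm2Z mulrC; apply: ler_pM => //.
  move: t0 t1; rewrite -natr1 mulrDl mul1r invfM ler_norml.
  have : 0 < N%:R^-1 :> R by rewrite invr_gt0.
  by lra.
have nd := norm2_ge0 (lin_interp gp t - mid nodes n).
by do 2! (apply: ler_pM => //; rewrite ?mulr_ge0//); rewrite ler_wpM2l.
Qed.

End Energy.

End LinInterp.

(** * Existence of discrete minimisers *)

Section Existence.
Variables (R : realType) (D : nat).
Notation V := 'rV[R]_D.
Variables (H : V -> 'M[R]_D) (c1 c2 : R).
Hypothesis contH : forall i j, continuous (fun x => H x i j).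
Hypothesis c1_gt0 : 0 < c1.
Hypothesis c2_gt0 : 0 < c2.
Hypothesis ellH : forall x u,
  c1 * norm2 u ^+ 2 <= gmet H x u u /\ gmet H x u u <= c2 * norm2 u ^+ 2.
Variables (X0 X1 : set V) (x0 x1 : V).
Hypothesis X0x0 : X0 x0.
Hypothesis X1x1 : X1 x1.
Hypothesis closedX0 : closed X0.
Hypothesis closedX1 : closed X1.
Hypothesis bndX : bounded_set X0 \/ bounded_set X1.

(** Normalised so that [c1 * line_bound] dominates the energy of the straight segment from [x0] to
    [x1]. *)
Definition line_bound : R := c2 * norm2 (x1 - x0) ^+ 2 / c1.

Lemma line_bound_ge0 : 0 <= line_bound.
Proof. by rewrite divr_ge0 ?(ltW c1_gt0)// mulr_ge0 ?sqr_ge0// ltW. Qed.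

Lemma Etra_nodes N (gp : 'I_N.+1 -> V) : Etra H gp = Edisc H N (nodes gp).
Proof. by []. Qed.

Definition line N (i : 'I_N.+1) : V := x0 + (i%:R / N%:R) *: (x1 - x0).

Lemma Etra_line N : (0 < N)%N -> Etra H (@line N) <= c1 * line_bound.
Proof.
move=> N0; have N0' : 0 < N%:R :> R by rewrite ltr0n.
have -> : c1 * line_bound = c2 * norm2 (x1 - x0) ^+ 2.
  by rewrite mulrC divfK// gt_eqF.
rewrite Etra_nodes /Edisc ler_pdivrMl// mulr_natl -[X in _ *+ X](card_ord N) -sumr_const.
apply: ler_sum => n _; apply: le_trans (ellH _ _).2 _.
have -> : vel N (nodes (@line N)) n = x1 - x0.
  rewrite /vel /nodes /line !inordK ?ltnS ?(ltnW (ltn_ord n))// -natr1.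
  by apply/rowP => j; rewrite !mxE; field; rewrite gt_eqF.
by [].
Qed.

(** Uses the energy bound alone, before any minimiser is known: one squared speed is at most the
    whole sum. The bound grows with [N], which is harmless for compactness on a fixed grid. *)
Lemma node_dist_coarse N x B i j : (0 < N)%N -> Edisc H N x <= c1 * B ->
  (i <= N)%N -> (j <= N)%N ->
  norm2 (x i - x j) <= N%:R * (N%:R^-1 * Num.sqrt (N%:R * B)).
Proof.
move=> N0 EB; have N0' : 0 < N%:R :> R by rewrite ltr0n.
set q := N%:R^-1 * _; have q0 : 0 <= q by rewrite mulr_ge0 ?sqrtr_ge0// invr_ge0.
wlog ij : i j / (j <= i)%N => [hw iN jN|iN jN].
  by case: (leqP j i) => [|/ltnW] h; [|rewrite norm2B]; exact: hw.
have step n : (n < N)%N -> norm2 (x n.+1 - x n) <= q.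
  move=> nN; have -> : x n.+1 - x n = N%:R^-1 *: vel N x n.
    by rewrite scalerA mulVf ?scale1r// gt_eqF.
  rewrite norm2Z ger0_norm ?invr_ge0// ler_pM2l ?invr_gt0//.
  rewrite -[leLHS](ger0_norm (norm2_ge0 _)) -sqrtr_sqr; apply: ler_wsqrtr.
  apply: le_trans (sum_vel_le c1_gt0 ellH N0 EB).
  rewrite (bigD1 (Ordinal nN))//= lerDl sumr_ge0// => k _; exact: sqr_ge0.
apply: (@le_trans _ _ ((i - j)%:R * q)); last first.
  by rewrite ler_wpM2r// ler_nat (leq_trans _ iN)// leq_subr.
rewrite -(subnKC ij) addKn; move: (i - j)%N (subnKC ij) => d e.
have {e iN} : (j + d <= N)%N by rewrite e.
elim: d => [|d IH] jdN; first by rewrite addn0 subrr norm2_0 mul0r.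
apply: le_trans (norm2_distD (x (j + d)%N) _ _) _.
rewrite -natr1 mulrDl mul1r addrC; rewrite addnS in jdN *.
by apply: lerD; [exact/IH/ltnW|exact: step].
Qed.

(** The node [i] is whichever endpoint lies in the bounded set; later arguments measure all nodes
    from it. *)
Lemma bounded_endpoint : exists r : R, forall N (x : nat -> V),
  X0 (x 0%N) -> X1 (x N) -> exists2 i, (i <= N)%N & norm2 (x i) <= r.
Proof.
have bnd (X : set V) : bounded_set X -> exists r : R, forall z, X z -> norm2 z <= r.
  move=> [M [_ hM]]; exists (D%:R * (M + 1)) => z Xz.
  apply: le_trans (norm2_le_mx_norm _) _; apply: ler_wpM2l; first exact: ler0n.
  by apply: hM Xz; rewrite ltrDl.
case: bndX => /bnd[r hr]; exists r => N x h0 h1.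
  by exists 0%N => //; exact: hr.
by exists N => //; exact: hr.
Qed.

Definition box (rho : R) N (i : 'I_N.+1) : set V :=
  [set z | `|z| <= rho] `&`
  ((if i == ord0 then X0 else setT) `&` (if i == ord_max then X1 else setT)).

Lemma box_compact rho N i : compact (@box rho N i).
Proof.
apply: bounded_closed_compact.
  exists rho; split; first exact: num_real.
  by move=> y hy z [/= hz _]; exact: le_trans hz (ltW hy).
apply: closedI.
  have -> : [set z : V | `|z| <= rho] = closed_ball_ Num.Def.normr (0 : V) rho.
    by apply/seteqP; split => z /=; rewrite /closed_ball_/= sub0r normrN.
  exact: closed_closed_ball_.
by apply: closedI; case: ifP => _ //; exact: closedT.
Qed.

Lemma Etra_continuous N :
  continuous (@Etra R D H N : prod_topology (fun _ : 'I_N.+1 => V) -> R).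
Proof.
pose W := prod_topology (fun _ : 'I_N.+1 => V).
move=> g; have pc i : (f : W) i @[f --> g] --> g i.
  exact: (@proj_continuous _ (fun _ : 'I_N.+1 => V) i g).
have cb n : vel N (nodes (f : W)) n @[f --> g] --> vel N (nodes g) n.
  exact: (cvgZ (cvg_cst _) (cvgB (pc _) (pc _))).
have cm n : mid (nodes (f : W)) n @[f --> g] --> mid (nodes g) n.
  exact: (cvgZ (cvg_cst _) (cvgD (pc _) (pc _))).
have FF : Filter (nbhs g) by exact: (@nbhs_filter W g).
have cg n := gmet_cvg contH (cm n) (cb n) (cb n).
have cs := @cvg_bigsum _ _ _ _ FF (index_enum 'I_N) _ _ (fun n : 'I_N => cg FF n).
by have /(_ FF) := @cvgM _ _ _ FF _ _ _ _ (cvg_cst (N%:R^-1 : R)) cs.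
Qed.

(** Direct method: curves with no more energy than the segment bound have all nodes within [rho],
    hence lie in a product of compact boxes that also encode the endpoint conditions. *)
Lemma tra_minimizer_exists N : (0 < N)%N ->
  exists gp : 'I_N.+1 -> V, is_tra_minimizer H X0 X1 gp.
Proof.
move=> N0; have [r hr] := bounded_endpoint.
pose rho := r + N%:R * (N%:R^-1 * Num.sqrt (N%:R * line_bound)).
pose A : set (prod_topology (fun _ : 'I_N.+1 => V)) := [set f | forall i, box rho i (f i)].
have inA (g : 'I_N.+1 -> V) : X0 (g ord0) -> X1 (g ord_max) ->
    Etra H g <= c1 * line_bound -> A g.
  move=> g0 g1 Eg i; split => /=; last first.
    by split; [case: eqP => // ->|case: eqP => // ->].
  have n0 : nodes g 0%N = g ord0 by congr (g _); apply/val_inj; rewrite /= inordK.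
  have nN : nodes g N = g ord_max by congr (g _); apply/val_inj; rewrite /= inordK.
  have [||j jN hj] := hr N (nodes g); [by rewrite n0|by rewrite nN|].
  have -> : g i = nodes g i by rewrite /nodes inord_val.
  apply: le_trans (mx_norm_le_norm2 _) _.
  rewrite -(subrK (nodes g j) (nodes g i)) addrC.
  apply: le_trans (norm2D _ _) _; apply: lerD => //.
  by apply: node_dist_coarse => //; rewrite -ltnS.
have Aline : A (@line N).
  apply: inA; last exact: Etra_line.
  - by rewrite /line mul0r scale0r addr0.
  - by rewrite /line divff ?pnatr_eq0 -?lt0n// scale1r addrC subrK.
have cA : compact A by apply: tychonoff => i; exact: box_compact.
have A0 : A !=set0 by exists (@line N).
have cE := continuous_subspaceT (A := A) (@Etra_continuous N).
have [gp gpA hgp] := compact_EVT_min A0 cA cE.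
exists gp; move: gpA; rewrite inE => gpA; split.
  by have [_ [+ _]] := gpA ord0; rewrite ?eqxx.
split; first by have [_ [_ +]] := gpA ord_max; rewrite ?eqxx.
(* A competitor outside the sublevel set already loses to the segment, which belongs to [A]. *)
move=> gq q0 q1; have [h|h] := leP (Etra H gq) (c1 * line_bound).
  by apply: hgp; rewrite inE; exact: inA.
apply: le_trans (ltW h); apply: le_trans (Etra_line N0).
by apply: hgp; rewrite inE.
Qed.

End Existence.

(** * Limits along an ultrafilter *)

(** A cluster point of an ultrafilter is a limit, since a neighbourhood's preimage or its complement
    lies in [U]. The same [U] works for every sequence, so no diagonal extraction over times is
    required. *)
Lemma ultra_lim (R : realType) (D : nat) (U : set_system nat) (f : nat -> 'rV[R]_D)
    (rho : R) : UltraFilter U -> (forall k, norm2 (f k) <= rho) ->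
  exists p, forall e, 0 < e -> U [set k | norm2 (f k - p) < e].
Proof.
move=> UF hf; have UP : ProperFilter U by exact: ultra_proper.
have cA : compact (closed_ball_ Num.Def.normr (0 : 'rV[R]_D) rho).
  apply: bounded_closed_compact; last exact: closed_closed_ball_.
  exists rho; split; first exact: num_real.
  move=> y hy z; rewrite /closed_ball_/= sub0r normrN => hz.
  exact: le_trans hz (ltW hy).
have [|p [_ cp]] := cA (f @ U) _.
  apply: (@filterE _ U) => k; rewrite /closed_ball_/= sub0r normrN.
  exact: le_trans (mx_norm_le_norm2 _) _.
exists p => e e0; have D1 : 0 < D%:R + 1 :> R by rewrite ltr_wpDl.
pose B := ball p (e / (D%:R + 1)).
have Bp : nbhs p B by apply: nbhsx_ballx; rewrite divr_gt0.
have [UB|UB] := in_ultra_setVsetC (f @^-1` B) UF; last first.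
  by have [z [zB /zB]] := cp (~` B) B UB Bp.
apply: filterS UB => k /= hk; rewrite norm2B.
apply: le_lt_trans (norm2_le_mx_norm _) _.
move: hk; rewrite /B -ball_normE/= => hk.
apply: (@le_lt_trans _ _ ((D%:R + 1) * `|p - f k|)).
  by rewrite ler_wpM2r// lerDl.
by rewrite mulrC -ltr_pdivlMr.
Qed.

Lemma closed_of_approx (R : realType) (D : nat) (X : set 'rV[R]_D) p : closed X ->
  (forall e, 0 < e -> exists2 z, X z & norm2 (z - p) < e) -> X p.
Proof.
move=> cX hp; apply: cX => B /nbhs_ballP[e /= e0 eB].
have [z Xz hz] := hp e e0; exists z; split => //; apply: eB.
rewrite -ball_normE/=; apply: le_lt_trans (mx_norm_le_norm2 _) _.
by rewrite norm2B.
Qed.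

(** * Projection of the line onto the unit interval *)

Section Clamp.
Variable R : realType.
Implicit Types s t : R.

Definition clamp t : R := Num.max 0 (Num.min 1 t).

Lemma clamp_id t : 0 <= t -> t <= 1 -> clamp t = t.
Proof. by move=> t0 t1; rewrite /clamp min_r// max_r. Qed.

Lemma clamp_cases t : [\/ t <= 0 /\ clamp t = 0, (0 <= t /\ t <= 1) /\ clamp t = t |
  1 <= t /\ clamp t = 1].
Proof.
have [t0|t0] := leP t 0.
  by constructor 1; split => //; rewrite /clamp min_r ?max_l// (le_trans t0).
have [t1|t1] := leP t 1; first by constructor 2; rewrite clamp_id ?(ltW t0).
by constructor 3; rewrite /clamp min_l ?max_r// ltW.
Qed.

Lemma clamp_itv t : 0 <= clamp t /\ clamp t <= 1.
Proof. by case: (clamp_cases t) => [][] h ->; lra. Qed.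

Lemma clamp_lip s t : `|clamp t - clamp s| <= `|t - s|.
Proof.
wlog st : s t / s <= t => [hw|].
  by have [|/ltW] := leP s t => h; [|rewrite distrC (distrC t)]; exact: hw.
rewrite (ger0_norm (_ : 0 <= t - s)) ?subr_ge0// ler_norml.
by case: (clamp_cases t) => [][] h ->; case: (clamp_cases s) => [][] h' ->; lra.
Qed.

(** If the projections differ, the segment from [s] to [t] passes through [clamp t], so the
    overshoot is at most the distance from [s] to [t]. *)
Lemma clamp_overshoot s t :
  `|t - clamp t| * `|clamp t - clamp s| <= (t - s) ^+ 2.
Proof.
have [->|n] := eqVneq (clamp t) (clamp s).
  by rewrite subrr normr0 mulr0 sqr_ge0.
rewrite -real_normK ?num_real// expr2; apply: ler_pM => //; last exact: clamp_lip.
have a1 := ler_norm (t - s); have a2 := ler_norm (s - t); rewrite distrC in a2.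
rewrite ler_norml.
case: (clamp_cases t) n => [][] h ->; case: (clamp_cases s) => [][] h' ->;
  rewrite ?eqxx// => _; lra.
Qed.

End Clamp.

(** * The limit curve and its regularity *)

Section Limit.
Variables (R : realType) (D : nat).
Notation V := 'rV[R]_D.
Implicit Types s t e : R.
Variables (x : nat -> nat -> V) (K M : R).
Hypothesis K_ge0 : 0 <= K.
Hypothesis M_ge0 : 0 <= M.
Hypothesis v_le : forall k n, norm2 (velx k.+1 (x k) n) <= K.
Hypothesis v_dist : forall k i d,
  norm2 (velx k.+1 (x k) (i + d) - velx k.+1 (x k) i) <= M * (d%:R / k.+1%:R).
Hypothesis x_dist : forall k i d, (i + d <= k.+1)%N ->
  norm2 (x k (i + d)%N - x k i) <= K * (d%:R / k.+1%:R).
Hypothesis x_taylor : forall k i d, (i + d <= k.+1)%N ->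
  norm2 (x k (i + d)%N - x k i - (d%:R / k.+1%:R) *: velx k.+1 (x k) i) <=
  M * (d%:R / k.+1%:R) ^+ 2.

(** The curve [x k] has [k.+1] cells. At [t = 1] the index is [k.+1], beyond the last cell, where
    [velx] keeps the last velocity. *)
Definition cell_of (k : nat) (t : R) : nat := Num.truncn (t * k.+1%:R).

Lemma cell_of_itv k t : 0 <= t ->
  (cell_of k t)%:R / k.+1%:R <= t /\ t < (cell_of k t)%:R / k.+1%:R + k.+1%:R^-1.
Proof.
move=> t0; have := truncn_itv (mulr_ge0 t0 (ler0n R k.+1)).
rewrite -/(cell_of k t) -[(cell_of k t).+1%:R]natr1 -ler_pdivrMr ?ltr0n// => /andP[-> h]; split => //.
by rewrite -ltr_pdivlMr ?ltr0n// mulrDl mul1r in h.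
Qed.

Lemma cell_of_le k t : t <= 1 -> (cell_of k t <= k.+1)%N.
Proof.
move=> t1; rewrite -[leqRHS](@natrK R); apply: le_truncn.
by rewrite ler_piMl.
Qed.

Lemma cell_of_homo k s t : s <= t -> (cell_of k s <= cell_of k t)%N.
Proof. by move=> st; apply: le_truncn; rewrite ler_wpM2r. Qed.

Lemma cell_of0 k : cell_of k 0 = 0%N.
Proof. by rewrite /cell_of mul0r truncn0. Qed.

Lemma cell_of1 k : cell_of k 1 = k.+1.
Proof. by rewrite /cell_of mul1r natrK. Qed.

Lemma cell_ofE k n t : n%:R / k.+1%:R < t -> t < n.+1%:R / k.+1%:R -> cell_of k t = n.
Proof.
move=> t0 t1; apply: truncn_def.
by rewrite -ler_pdivrMr ?ltr0n// (ltW t0) -ltr_pdivlMr ?ltr0n.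
Qed.

(** Both times are rounded down by less than one cell, so the two errors differ by less than one
    cell. *)
Lemma cell_of_gap k s t : 0 <= s -> s <= t -> t <= 1 ->
  exists d, [/\ cell_of k t = (cell_of k s + d)%N, (cell_of k s + d <= k.+1)%N &
    `|d%:R / k.+1%:R - (t - s)| <= k.+1%:R^-1].
Proof.
move=> s0 st t1; have h := cell_of_homo k st.
exists (cell_of k t - cell_of k s)%N; rewrite subnKC//; split => //.
  exact: cell_of_le.
have [p1 p2] := cell_of_itv k s0; have [q1 q2] := cell_of_itv k (le_trans s0 st).
rewrite natrB// mulrBl ler_norml.
set A := (cell_of k t)%:R / k.+1%:R in q1 q2 *.
set B := (cell_of k s)%:R / k.+1%:R in p1 p2 *.
set C := k.+1%:R^-1 in p2 q2 *; clearbody A B C.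
apply/andP; split.
- by lra.
- by lra.
Qed.

Lemma ler_distl_trans (q p c e : R) : `|q - p| <= c -> c <= e -> q <= p + e.
Proof. by rewrite ler_norml => /andP[_]; lra. Qed.

Variable U : set_system nat.
Hypothesis UU : UltraFilter U.
Hypothesis Uoo : \oo `<=` U.
Variables gam b : R -> V.
Hypothesis gamP : forall t, 0 <= t -> t <= 1 -> forall e, 0 < e ->
  U [set k | norm2 (x k (cell_of k t) - gam t) < e].
Hypothesis bP : forall t, 0 <= t -> t <= 1 -> forall e, 0 < e ->
  U [set k | norm2 (velx k.+1 (x k) (cell_of k t) - b t) < e].

Let UP : ProperFilter U := ultra_proper.

Lemma small_mesh e : 0 < e -> U [set k | k.+1%:R^-1 < e].
Proof.
by move=> e0; apply: Uoo; exact: (near_infty_natSinv_lt (PosNum e0)).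
Qed.

(** Finitely many members of [U] meet, so one grid is accurate at [s] and [t] together; discrete
    estimates at that grid then pass to the limit with an error linear in [e]. *)
Lemma lim_pick s t e : 0 <= s -> s <= 1 -> 0 <= t -> t <= 1 -> 0 < e ->
  exists k, [/\ k.+1%:R^-1 <= e,
    norm2 (x k (cell_of k s) - gam s) <= e, norm2 (x k (cell_of k t) - gam t) <= e,
    norm2 (velx k.+1 (x k) (cell_of k s) - b s) <= e &
    norm2 (velx k.+1 (x k) (cell_of k t) - b t) <= e].
Proof.
move=> s0 s1 t0 t1 e0.
have [k [h0 [h1 [h2 [h3 h4]]]]] := filter_ex (filterI (small_mesh e0)
  (filterI (gamP s0 s1 e0) (filterI (gamP t0 t1 e0) (filterI (bP s0 s1 e0) (bP t0 t1 e0))))).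
by exists k; split; exact: ltW.
Qed.

Lemma b_le t : 0 <= t -> t <= 1 -> norm2 (b t) <= K.
Proof.
move=> t0 t1; apply: (@ler_addgt0_mul _ _ _ 1) => e e0 e1.
have [k [_ _ _ h _]] := lim_pick t0 t1 t0 t1 e0.
rewrite -(subrK (velx k.+1 (x k) (cell_of k t)) (b t)) addrC mulr1.
by apply: le_trans (norm2D _ _) _; apply: lerD => //; rewrite norm2B.
Qed.

Lemma b_lip s t : 0 <= s -> s <= t -> t <= 1 -> norm2 (b t - b s) <= M * (t - s).
Proof.
move=> s0 st t1; apply: (@ler_addgt0_mul _ _ _ (2 + M)) => e e0 e1.
have s1 := le_trans st t1; have t0 := le_trans s0 st.
have [k [mesh _ _ hs ht]] := lim_pick s0 s1 t0 t1 e0.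
have [d [dE dN dd]] := cell_of_gap k s0 st t1.
have h1 := norm2_distD (velx k.+1 (x k) (cell_of k t)) (b t) (b s).
have h2 := norm2_distD (velx k.+1 (x k) (cell_of k s)) (velx k.+1 (x k) (cell_of k t)) (b s).
have h3 : norm2 (velx k.+1 (x k) (cell_of k t) - velx k.+1 (x k) (cell_of k s)) <= M * (t - s + e).
  rewrite dE; apply: le_trans (v_dist _ _ _) _; rewrite ler_wpM2l//.
  exact: ler_distl_trans dd mesh.
rewrite norm2B in ht.
have -> : e * (2 + M) = 2 * e + M * e by ring.
rewrite mulrDr in h3.
by lra.
Qed.

Lemma gam_taylor s t : 0 <= s -> s <= t -> t <= 1 ->
  norm2 (gam t - gam s - (t - s) *: b s) <= M * (t - s) ^+ 2.
Proof.
(* [3] pays for two node errors and one velocity error, [K] for rounding [t - s] to the grid,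
   [3 * M] for that rounding inside the square. *)
move=> s0 st t1; apply: (@ler_addgt0_mul _ _ _ (3 + K + 3 * M)) => e e0 e1.
have s1 := le_trans st t1; have t0 := le_trans s0 st.
have [k [mesh gs gt bs _]] := lim_pick s0 s1 t0 t1 e0.
have [d [dE dN dd]] := cell_of_gap k s0 st t1.
set v := velx k.+1 (x k) (cell_of k s) in bs *.
set q := d%:R / k.+1%:R in dd *.
have tay : norm2 (x k (cell_of k t) - x k (cell_of k s) - q *: v) <= M * q ^+ 2.
  by rewrite dE; exact: x_taylor.
have -> : gam t - gam s - (t - s) *: b s =
    (x k (cell_of k t) - x k (cell_of k s) - q *: v)
    + ((gam t - x k (cell_of k t)) + ((x k (cell_of k s) - gam s)
    + ((q - (t - s)) *: v + (t - s) *: (v - b s)))).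
  by apply/rowP => j; rewrite !mxE; ring.
have n1 : norm2 ((q - (t - s)) *: v) <= e * K.
  rewrite norm2Z; apply: ler_pM => //; [exact: norm2_ge0|exact: le_trans dd mesh|].
  exact: v_le.
have n2 : norm2 ((t - s) *: (v - b s)) <= e.
  rewrite norm2Z ger0_norm ?subr_ge0// -[leRHS]mul1r.
  by apply: ler_pM; rewrite ?norm2_ge0 ?subr_ge0//; lra.
have n3 : M * q ^+ 2 <= M * (t - s) ^+ 2 + 3 * (M * e).
  have -> : M * (t - s) ^+ 2 + 3 * (M * e) = M * ((t - s) ^+ 2 + 3 * e) by ring.
  rewrite ler_wpM2l//.
  have q0 : 0 <= q by rewrite divr_ge0.
  have q1 : q <= t - s + e by exact: ler_distl_trans dd mesh.
  apply: (@le_trans _ _ ((t - s + e) ^+ 2)).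
    by rewrite ler_sqr ?nnegrE//; exact: le_trans q1.
  have p0 : 0 <= t - s by rewrite subr_ge0.
  have p1 : t - s <= 1 by lra.
  by move: (t - s) p0 p1 => p p0 p1; rewrite sqrrD; nra.
have n4 := norm2D (x k (cell_of k t) - x k (cell_of k s) - q *: v) ((gam t - x k (cell_of k t)) + ((x k (cell_of k s) - gam s)
    + ((q - (t - s)) *: v + (t - s) *: (v - b s)))).
have n5 := norm2D (gam t - x k (cell_of k t)) ((x k (cell_of k s) - gam s)
    + ((q - (t - s)) *: v + (t - s) *: (v - b s))).
have n6 := norm2D (x k (cell_of k s) - gam s)
    ((q - (t - s)) *: v + (t - s) *: (v - b s)).
have n7 := norm2D ((q - (t - s)) *: v) ((t - s) *: (v - b s)).
rewrite norm2B in gt.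
have -> : e * (3 + K + 3 * M) = 3 * e + e * K + 3 * (M * e) by ring.
by lra.
Qed.

(** For [t < s], expand at [t] instead and replace [b t] by [b s]; the Lipschitz bound on [b] makes
    this cost a second [M]. *)
Lemma gam_taylor2 s t : 0 <= s -> s <= 1 -> 0 <= t -> t <= 1 ->
  norm2 (gam t - gam s - (t - s) *: b s) <= 2 * M * (t - s) ^+ 2.
Proof.
move=> s0 s1 t0 t1; have Mq : 0 <= M * (t - s) ^+ 2 by rewrite mulr_ge0// sqr_ge0.
have [st|ts] := leP s t.
  by have := gam_taylor s0 st t1; lra.
have h1 := gam_taylor t0 (ltW ts) s1.
have h2 := b_lip t0 (ltW ts) s1.
have -> : gam t - gam s - (t - s) *: b s =
    - (gam s - gam t - (s - t) *: b t) + (s - t) *: (b s - b t).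
  by apply/rowP => j; rewrite !mxE; ring.
apply: le_trans (norm2D _ _) _; rewrite norm2N norm2Z ger0_norm ?subr_ge0 ?(ltW ts)//.
have h3 : (s - t) * norm2 (b s - b t) <= (s - t) * (M * (s - t)).
  by rewrite ler_wpM2l// subr_ge0 ltW.
have -> : 2 * M * (t - s) ^+ 2 = M * (s - t) ^+ 2 + (s - t) * (M * (s - t)) by ring.
exact: lerD.
Qed.

(** The limit is known on the unit interval only; continuing it along its end tangents gives a [C^1]
    map of the line. *)
Definition gamx (t : R) : V := gam (clamp t) + (t - clamp t) *: b (clamp t).
Definition bx (t : R) : V := b (clamp t).

Lemma bx_lip s t : norm2 (bx t - bx s) <= M * `|t - s|.
Proof.
have [s0 s1] := clamp_itv s; have [t0 t1] := clamp_itv t.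
apply: (@le_trans _ _ (M * `|clamp t - clamp s|)); last first.
  by rewrite ler_wpM2l// clamp_lip.
have [h|/ltW h] := leP (clamp s) (clamp t).
  by rewrite ger0_norm ?subr_ge0//; exact: b_lip.
by rewrite norm2B distrC ger0_norm ?subr_ge0//; exact: b_lip.
Qed.

(** The inner Taylor remainder gives [2 * M]; the tangent extension adds [M] through
    [clamp_overshoot]. *)
Lemma gamx_taylor s t :
  norm2 (gamx t - gamx s - (t - s) *: bx s) <= 3 * M * (t - s) ^+ 2.
Proof.
have [s0 s1] := clamp_itv s; have [t0 t1] := clamp_itv t.
have -> : gamx t - gamx s - (t - s) *: bx s =
    (gam (clamp t) - gam (clamp s) - (clamp t - clamp s) *: b (clamp s)) +
    (t - clamp t) *: (b (clamp t) - b (clamp s)).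
  by rewrite /gamx /bx; apply/rowP => j; rewrite !mxE; ring.
apply: le_trans (norm2D _ _) _; rewrite norm2Z.
have h1 := gam_taylor2 s0 s1 t0 t1.
have h2 : (clamp t - clamp s) ^+ 2 <= (t - s) ^+ 2.
  rewrite -real_normK ?num_real// -[leRHS]real_normK ?num_real//.
  by rewrite ler_sqr ?nnegrE// clamp_lip.
have h3 : norm2 (b (clamp t) - b (clamp s)) <= M * `|clamp t - clamp s|.
  have [h|/ltW h] := leP (clamp s) (clamp t).
    by rewrite ger0_norm ?subr_ge0//; exact: b_lip.
  by rewrite norm2B distrC ger0_norm ?subr_ge0//; exact: b_lip.
have h4 := ler_wpM2l (normr_ge0 (t - clamp t)) h3.
have h5 := ler_wpM2l M_ge0 (clamp_overshoot s t).
have h6 := ler_wpM2l M_ge0 h2.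
rewrite mulrCA in h4.
by lra.
Qed.

Lemma gamx_C1 : C1curve gamx /\ derive1 gamx = bx.
Proof. exact: C1curve_of_taylor gamx_taylor bx_lip. Qed.

Lemma bx_le t : norm2 (bx t) <= K.
Proof. by have [t0 t1] := clamp_itv t; exact: b_le. Qed.

Lemma gamx0_closed (X : set V) : closed X -> (forall k, X (x k 0%N)) -> X (gamx 0).
Proof.
move=> cX hX; rewrite /gamx clamp_id// subrr scale0r addr0.
apply: closed_of_approx cX _ => e e0.
have [k] := filter_ex (gamP (lexx 0) ler01 e0); rewrite /= cell_of0 => h.
by exists (x k 0%N).
Qed.

Lemma gamx1_closed (X : set V) : closed X -> (forall k, X (x k k.+1)) -> X (gamx 1).
Proof.
move=> cX hX; rewrite /gamx clamp_id// subrr scale0r addr0.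
apply: closed_of_approx cX _ => e e0.
have [k] := filter_ex (gamP ler01 (lexx 1) e0); rewrite /= cell_of1 => h.
by exists (x k k.+1).
Qed.

(** Pointwise convergence at the finitely many nodes of a coarse grid, fixed before [k], becomes
    uniform because the limit and the discrete curves share Lipschitz bounds. *)
Lemma uniform_approx e : 0 < e -> e <= 1 -> exists k, k.+1%:R^-1 <= e /\
  forall n t, (n < k.+1)%N -> n%:R / k.+1%:R < t -> t < n.+1%:R / k.+1%:R ->
    norm2 (gamx t - mid (x k) n) <= (4 * K + M + 1) * e /\
    norm2 (bx t - vel k.+1 (x k) n) <= (3 * M + 1) * e.
Proof.
move=> e0 e1.
have [q /= /ltW qe] := filter_ex (small_mesh e0).
have q0 : 0 < q.+1%:R :> R by rewrite ltr0n.
have gt0 (j : 'I_q.+2) : 0 <= j%:R / q.+1%:R :> R by rewrite divr_ge0.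
have gt1 (j : 'I_q.+2) : j%:R / q.+1%:R <= 1 :> R.
  by rewrite ler_pdivrMr// mul1r ler_nat -ltnS.
have UK : U [set k | forall j : 'I_q.+2,
    norm2 (x k (cell_of k (j%:R / q.+1%:R)) - gam (j%:R / q.+1%:R)) < e /\
    norm2 (velx k.+1 (x k) (cell_of k (j%:R / q.+1%:R)) - b (j%:R / q.+1%:R)) < e].
  apply: (@filter_forall _ _ (fun (j : 'I_q.+2) k =>
    norm2 (x k (cell_of k (j%:R / q.+1%:R)) - gam (j%:R / q.+1%:R)) < e /\
    norm2 (velx k.+1 (x k) (cell_of k (j%:R / q.+1%:R)) - b (j%:R / q.+1%:R)) < e) U) => j.
  exact: filterI (gamP (gt0 j) (gt1 j) e0) (bP (gt0 j) (gt1 j) e0).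
have [k [/= /ltW mesh hk]] := filter_ex (filterI (small_mesh e0) UK).
exists k; split => // n t nk nt tn.
have k0 : 0 < k.+1%:R :> R by rewrite ltr0n.
have t0 : 0 <= t by apply: le_trans (ltW nt); rewrite divr_ge0.
have t1 : t <= 1.
  by apply: le_trans (ltW tn) _; rewrite ler_pdivrMr// mul1r ler_nat.
have tE := cell_ofE nt tn.
rewrite /gamx /bx clamp_id// subrr scale0r addr0.
have vE : vel k.+1 (x k) n = velx k.+1 (x k) n.
  by rewrite /velx (minn_idPl _).
pose j : 'I_q.+2 := inord (cell_of q t).
have jE : j = cell_of q t :> nat by rewrite inordK// ltnS cell_of_le.
pose s : R := j%:R / q.+1%:R.
have [s_le s_ge] := cell_of_itv q t0; rewrite -jE -/s in s_le s_ge.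
have s0 : 0 <= s by exact: gt0.
have ts : t - s <= e.
  by rewrite lerBlDl; apply: le_trans (ltW s_ge) _; rewrite lerD2l.
have [/ltW g1 /ltW b1] := hk j; rewrite -/s in g1 b1.
have [d [dE dN dd]] := cell_of_gap k s0 s_le t1; rewrite tE in dE.
(* The time from the coarse node [s] to [t] is at most [e]; rounding on the fine grid adds at most
   another [e]. *)
have dq : d%:R / k.+1%:R <= 2 * e.
  by apply: le_trans (ler_distl_trans dd mesh) _; lra.
have Ke : 0 <= K * e by rewrite mulr_ge0// ltW.
have Me : 0 <= M * e by rewrite mulr_ge0// ltW.
split.
- have a1 : norm2 (gam t - gam s) <= (K + M) * e.
    rewrite -(subrK ((t - s) *: b s) (gam t - gam s)).
    apply: le_trans (norm2D _ _) _; rewrite addrC mulrDl norm2Z ger0_norm ?subr_ge0//.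
    apply: lerD.
      by rewrite mulrC; apply: ler_pM; rewrite ?norm2_ge0 ?subr_ge0 ?b_le// (le_trans s_le).
    apply: le_trans (gam_taylor s0 s_le t1) _; rewrite ler_wpM2l//.
    have p0 : 0 <= t - s by rewrite subr_ge0.
    by move: (t - s) p0 ts => p p0 pe; nra.
  have a2 : norm2 (x k n - x k (cell_of k s)) <= 2 * (K * e).
    rewrite dE; apply: le_trans (x_dist dN) _.
    have -> : 2 * (K * e) = K * (2 * e) by ring.
    exact: ler_wpM2l.
  have a3 : norm2 (x k n - mid (x k) n) <= K * e.
    have -> : x k n - mid (x k) n = (- 2^-1) *: (x k (n + 1)%N - x k n).
      by rewrite addn1; apply/rowP => i; rewrite !mxE; field.
    rewrite norm2Z normrN ger0_norm ?invr_ge0//.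
    have nk1 : (n + 1 <= k.+1)%N by rewrite addn1.
    have mesh1 : 1%:R / k.+1%:R <= e by rewrite mul1r.
    have := le_trans (x_dist nk1) (ler_wpM2l K_ge0 mesh1).
    rewrite ler_pdivrMl//; lra.
  have t2 := norm2_distD (gam s) (gam t) (mid (x k) n).
  have t3 := norm2_distD (x k (cell_of k s)) (gam s) (mid (x k) n).
  have t4 := norm2_distD (x k n) (x k (cell_of k s)) (mid (x k) n).
  rewrite norm2B in g1; rewrite norm2B in a2.
  have -> : (4 * K + M + 1) * e = 4 * (K * e) + M * e + e by ring.
  have a1' : (K + M) * e = K * e + M * e by ring.
  by lra.
- rewrite vE.
  have a1 : norm2 (b t - b s) <= M * e.
    by apply: le_trans (b_lip s0 s_le t1) _; rewrite ler_wpM2l.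
  have a2 : norm2 (velx k.+1 (x k) n - velx k.+1 (x k) (cell_of k s)) <= 2 * (M * e).
    rewrite dE; apply: le_trans (v_dist _ _ _) _.
    have -> : 2 * (M * e) = M * (2 * e) by ring.
    exact: ler_wpM2l.
  have t2 := norm2_distD (b s) (b t) (velx k.+1 (x k) n).
  have t3 := norm2_distD (velx k.+1 (x k) (cell_of k s)) (b s) (velx k.+1 (x k) n).
  rewrite norm2B in b1; rewrite norm2B in a2.
  have -> : (3 * M + 1) * e = 3 * (M * e) + e by ring.
  by lra.
Qed.

End Limit.

(** * The continuous minimiser as a limit of discrete ones *)

Section Minimizer.
Variables (R : realType) (D : nat).
Notation V := 'rV[R]_D.
Variables (H : V -> 'M[R]_D) (c1 c2 L : R).
Hypothesis contH : forall i j, continuous (fun x => H x i j).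
Hypothesis symH : forall x, (H x)^T = H x.
Hypothesis c1_gt0 : 0 < c1.
Hypothesis c2_gt0 : 0 < c2.
Hypothesis ellH : forall x u,
  c1 * norm2 u ^+ 2 <= gmet H x u u /\ gmet H x u u <= c2 * norm2 u ^+ 2.
Hypothesis L_ge0 : 0 <= L.
Hypothesis lipH : forall x y, opnorm (H x - H y) <= L * norm2 (x - y).
Variables (X0 X1 : set V) (x0 x1 : V).
Hypothesis X0x0 : X0 x0.
Hypothesis X1x1 : X1 x1.
Hypothesis closedX0 : closed X0.
Hypothesis closedX1 : closed X1.
Hypothesis bndX : bounded_set X0 \/ bounded_set X1.

Let B : R := line_bound c1 c2 x0 x1.
Let K : R := speed_bound c1 c2 L B.
Let M : R := accel_bound c1 c2 L B.

Let B_ge0 : 0 <= B. Proof. exact: line_bound_ge0. Qed.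
Let K_ge0 : 0 <= K. Proof. exact: speed_bound_ge0. Qed.
Let M_ge0 : 0 <= M. Proof. exact: accel_bound_ge0. Qed.

Definition disc_minimizer N (x : nat -> V) :=
  [/\ X0 (x 0%N), X1 (x N) &
    forall y, X0 (y 0%N) -> X1 (y N) -> Edisc H N x <= Edisc H N y].

Lemma Edisc_sampled N (y : nat -> V) :
  Edisc H N y = Etra H (fun i : 'I_N.+1 => y i).
Proof.
rewrite Etra_nodes /Edisc; congr (_ * _); apply: eq_bigr => n _.
by rewrite /mid /vel /nodes !inordK// ltnS// ltnW.
Qed.

Lemma tra_disc_minimizer N (gp : 'I_N.+1 -> V) :
  is_tra_minimizer H X0 X1 gp -> disc_minimizer N (nodes gp).
Proof.
move=> [h0 [h1 hmin]]; split.
- by rewrite /nodes (_ : inord 0 = ord0)//; apply/val_inj; rewrite /= inordK.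
- by rewrite /nodes (_ : inord N = ord_max)//; apply/val_inj; rewrite /= inordK.
by move=> y y0 y1; rewrite -Etra_nodes Edisc_sampled; exact: hmin.
Qed.

Lemma disc_minimizer_critical N x : disc_minimizer N x -> disc_critical H N x.
Proof. by move=> [h0 h1 hmin] y y0 y1; apply: hmin; rewrite ?y0 ?y1. Qed.

Lemma disc_minimizer_le N x : (0 < N)%N -> disc_minimizer N x ->
  Edisc H N x <= c1 * B.
Proof.
move=> N0 [_ _ hmin]; apply: le_trans (Etra_line c1_gt0 ellH x0 x1 N0).
rewrite Etra_nodes; apply: hmin; rewrite /nodes /line inordK//.
- by rewrite mul0r scale0r addr0.
- by rewrite divff ?pnatr_eq0 -?lt0n// scale1r addrC subrK.
Qed.

Lemma disc_minimizer_vel_le N x n : (n < N)%N -> disc_minimizer N x ->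
  norm2 (vel N x n) <= K.
Proof.
move=> nN mx; have N0 : (0 < N)%N by case: N nN {mx}.
apply: (vel_le symH c1_gt0 c2_gt0 ellH L_ge0 lipH) => //.
  exact: disc_minimizer_critical.
exact: disc_minimizer_le.
Qed.

(** First the base point is moved, then the velocity, using that the difference of two values of the
    form is the form at [u - v] and [u + v]. *)
Lemma gmet_near z z' u v d d' : norm2 u <= K -> norm2 v <= K ->
  norm2 (z - z') <= d -> norm2 (u - v) <= d' ->
  gmet H z u u <= gmet H z' v v + (L * K ^+ 2 * d + 2 * c2 * K * d').
Proof.
move=> uK vK hd hd'; have nu := norm2_ge0 u; have nv := norm2_ge0 v.
have h1 : gmet H z u u - gmet H z' u u <= L * K ^+ 2 * d.
  apply: le_trans (ler_norm _) _; apply: le_trans (gmet_lip _ _ _ _ lipH) _.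
  have -> : L * K ^+ 2 * d = L * d * K * K by ring.
  have nz := norm2_ge0 (z - z').
  by do 2! (apply: ler_pM => //; rewrite ?mulr_ge0//); rewrite ler_wpM2l.
have h2 : gmet H z' u u - gmet H z' v v <= 2 * c2 * K * d'.
  have -> : gmet H z' u u - gmet H z' v v = gmet H z' (u - v) (u + v).
    by rewrite !gmet_lin (gmetC (x := z') v u)//; ring.
  apply: le_trans (ler_norm _) _.
  apply: le_trans (gmet_le symH c1_gt0 c2_gt0 ellH _ _ _) _.
  have -> : 2 * c2 * K * d' = c2 * d' * (K + K) by ring.
  apply: ler_pM; rewrite ?norm2_ge0//.
  - by rewrite mulr_ge0 ?norm2_ge0// ltW.
  - by rewrite ler_pM2l.
  - by apply: le_trans (norm2D _ _) _; exact: lerD.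
by lra.
Qed.

Lemma C1curve_pcurve (f : R -> V) : C1curve f -> pcurve f.
Proof.
move=> cf; split; first by apply: derivable_within_continuous => t _; exact: cf.1.
exists 1%N, (fun n => n%:R); do 3! split => //; first by case.
by move=> i _; exists f.
Qed.

(** The speed bound [K] is returned with the minimiser: it is what controls the sampling error in
    the upper bound on the discrete energy. *)
Lemma energy_minimizer_exists : exists gmin : R -> V,
  [/\ pcurve_between X0 X1 gmin, regular_off [::] K gmin &
    forall s, pcurve_between X0 X1 s -> energy H gmin <= energy H s].
Proof.
have ex k : exists x, disc_minimizer k.+1 x.
  have [gp hgp] := tra_minimizer_exists contH c1_gt0 ellH X0x0 X1x1 closedX0 closedX1 bndX (ltn0Sn k).
  by exists (nodes gp); exact: tra_disc_minimizer.
have [x hx] := choice ex.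
have crit k := disc_minimizer_critical (hx k).
have EB k := disc_minimizer_le (ltn0Sn k) (hx k).
have v_le k n : norm2 (velx k.+1 (x k) n) <= K.
  exact: (velx_le symH c1_gt0 c2_gt0 ellH L_ge0 lipH n B_ge0 (ltn0Sn k) (crit k) (EB k)).
have v_dist k i d : norm2 (velx k.+1 (x k) (i + d) - velx k.+1 (x k) i) <= M * (d%:R / k.+1%:R).
  exact: (velx_dist symH c1_gt0 c2_gt0 ellH L_ge0 lipH i d B_ge0 (ltn0Sn k) (crit k) (EB k)).
have x_dist k i d : (i + d <= k.+1)%N -> norm2 (x k (i + d)%N - x k i) <= K * (d%:R / k.+1%:R).
  exact: (node_dist symH c1_gt0 c2_gt0 ellH L_ge0 lipH B_ge0 (ltn0Sn k) (crit k) (EB k)).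
have x_taylor k i d : (i + d <= k.+1)%N ->
    norm2 (x k (i + d)%N - x k i - (d%:R / k.+1%:R) *: velx k.+1 (x k) i) <=
    M * (d%:R / k.+1%:R) ^+ 2.
  exact: (node_taylor symH c1_gt0 c2_gt0 ellH L_ge0 lipH B_ge0 (ltn0Sn k) (crit k) (EB k)).
have [r hr] := bounded_endpoint bndX.
(* One endpoint is bounded by [r], and no two nodes are further apart than [K], the maximal speed
   over unit time. *)
have x_le k n : (n <= k.+1)%N -> norm2 (x k n) <= r + K.
  move=> nk; have [h0 h1 _] := hx k; have [i ik hi] := hr k.+1 (x k) h0 h1.
  have dist a b : (a <= b)%N -> (b <= k.+1)%N -> norm2 (x k b - x k a) <= K.
    move=> ab bk; have := x_dist k a (b - a)%N; rewrite subnKC// => /(_ bk).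
    move=> /le_trans; apply; rewrite -[leRHS]mulr1 ler_wpM2l//.
    by rewrite ler_pdivrMr ?ltr0n// mul1r ler_nat (leq_trans (leq_subr _ _)).
  rewrite -(subrK (x k i) (x k n)) addrC; apply: le_trans (norm2D _ _) _.
  apply: lerD => //; have [ni|/ltnW ni] := leqP n i; last exact: dist.
  by rewrite norm2B; exact: dist.
have [U [UU Uoo]] := ultraFilterLemma (F := \oo) _.
have exg (t : R) : exists p : V, 0 <= t -> t <= 1 -> forall e : R, 0 < e ->
    U [set k | norm2 (x k (cell_of k t) - p) < e].
  have [t1|t1] := leP t 1; last by exists 0.
  have [|p hp] := @ultra_lim _ _ U (fun k => x k (cell_of k t)) (r + K) UU.
    by move=> k; apply: x_le; exact: cell_of_le.
  by exists p.
have exb (t : R) : exists p : V, 0 <= t -> t <= 1 -> forall e : R, 0 < e ->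
    U [set k | norm2 (velx k.+1 (x k) (cell_of k t) - p) < e].
  have [|p hp] := @ultra_lim _ _ U (fun k => velx k.+1 (x k) (cell_of k t)) K UU.
    by move=> k; exact: v_le.
  by exists p.
have [gam gamP] := choice exg; have [b bP] := choice exb.
have [C1g dg] := gamx_C1 M_ge0 v_le v_dist x_taylor UU Uoo gamP bP.
have bK := bx_le v_le UU Uoo gamP bP.
pose g := gamx gam b.
have reg : regular_off [::] K g.
  split; [exact: K_ge0| |].
    by apply: derivable_within_continuous => t _; exact: C1g.1.
  by move=> t _ _ _; split; [exact: C1g.1|exact: C1g.2|rewrite dg].
exists g; split; [|exact: reg|].
  split; first exact: (C1curve_pcurve C1g).
  split; first by apply: (gamx0_closed UU b gamP closedX0) => k; have [] := hx k.
  by apply: (gamx1_closed UU b gamP closedX1) => k; have [] := hx k.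
move=> s [ps [s0 s1]]; have [S [Ks rs]] := pcurve_regular ps.
(* The error of [gmet_near] for the two distances supplied by [uniform_approx], divided by [e]. *)
pose Q := L * K ^+ 2 * (4 * K + M + 1) + 2 * c2 * K * (3 * M + 1).
apply: (@ler_addgt0_mul _ _ _ (L * Ks ^+ 3 + Q)) => e e0 e1.
have [k [mesh hk]] := uniform_approx K_ge0 M_ge0 v_le v_dist x_dist x_taylor UU Uoo gamP bP e0 e1.
have h1 : energy H g <= Edisc H k.+1 (x k) + Q * e.
  apply: (energy_le_Edisc contH c1_gt0 c2_gt0 ellH (ltn0Sn k) reg) => n t nk t0 t1 _.
  have [d1 d2] := hk n t nk t0 t1; rewrite dg.
  have -> : Q * e = L * K ^+ 2 * ((4 * K + M + 1) * e) + 2 * c2 * K * ((3 * M + 1) * e).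
    by rewrite /Q; ring.
  apply: gmet_near => //; exact: disc_minimizer_vel_le (hx k).
have h2 : Edisc H k.+1 (x k) <= Edisc H k.+1 (fun n => s (n%:R / k.+1%:R)).
  by have [_ _ hmin] := hx k; apply: hmin; rewrite ?mul0r ?divff.
have h3 := Edisc_sample_le contH symH c1_gt0 c2_gt0 ellH L_ge0 lipH (ltn0Sn k) rs.
have h4 : L * Ks ^+ 3 / k.+1%:R <= L * Ks ^+ 3 * e.
  by rewrite ler_wpM2l// mulr_ge0// exprn_ge0//; case: rs.
have -> : e * (L * Ks ^+ 3 + Q) = L * Ks ^+ 3 * e + Q * e by ring.
apply: le_trans h1 _; rewrite addrA lerD2r.
apply: le_trans h2 _; apply: le_trans h3 _.
by rewrite lerD2l.
Qed.

End Minimizer.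

(** * The constant and the three inequalities *)

Theorem theorem1p1 (R : realType) (D : nat) (X0 X1 : set 'rV[R]_D) :
  (0 < D)%N ->
  X0 !=set0 -> X1 !=set0 -> closed X0 -> closed X1 ->
  (bounded_set X0 \/ bounded_set X1) ->
  exists Cf : R -> R -> R -> R -> R,
  forall (H : 'rV[R]_D -> 'M[R]_D) (c1 c2 LH : R),
    (forall i j, smooth (fun x => H x i j)) ->
    (forall x, (H x)^T = H x) ->
    0 < c1 -> 0 < c2 ->
    (forall x u, c1 * norm2 u ^+ 2 <= gmet H x u u /\ gmet H x u u <= c2 * norm2 u ^+ 2) ->
    0 <= LH ->
    (forall x y, opnorm (H x - H y) <= LH * norm2 (x - y)) ->
    let C := Cf c1 c2 LH (gsetdist H X0 X1) in
    exists gmin : R -> 'rV[R]_D,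
      pcurve_between X0 X1 gmin /\
      (forall gam, pcurve_between X0 X1 gam -> energy H gmin <= energy H gam) /\
      forall (N : nat) (gp : 'I_N.+1 -> 'rV[R]_D),
        (1 <= N)%N -> is_tra_minimizer H X0 X1 gp ->
        energy H gmin - C / Num.sqrt N%:R <= energy H (lin_interp gp) - C / Num.sqrt N%:R /\
        energy H (lin_interp gp) - C / Num.sqrt N%:R <= Etra H gp /\
        Etra H gp <= energy H gmin + C / N%:R.
Proof.
move=> D0 [x0 X0x0] [x1 X1x1] cX0 cX1 bX.
(* The points [x0] and [x1] are fixed before the metric, so this speed bound involves the sets only
   through them. *)
exists (fun c1 c2 L _ => L * speed_bound c1 c2 L (line_bound c1 c2 x0 x1) ^+ 3).
move=> H c1 c2 L smoothH symH c10 c20 ellH L0 lipH.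
have contH i j : continuous (fun x => H x i j) by exact: (smoothH i j 0%N).
set K := speed_bound _ _ _ _; set C := L * K ^+ 3.
have K0 : 0 <= K by apply: speed_bound_ge0 => //; exact: line_bound_ge0.
have [g [bg rg ming]] := energy_minimizer_exists contH symH c10 c20 ellH L0 lipH
  X0x0 X1x1 cX0 cX1 bX.
exists g; split; [exact: bg|split; [exact: ming|move=> N gp N0 mgp]].
have N0' : 0 < N%:R :> R by rewrite ltr0n.
have dm := tra_disc_minimizer mgp; have [gp0 [gp1 hmin]] := mgp.
split; [|split].
- rewrite lerD2r; apply: ming; split; first exact: lin_interp_pcurve.
  by rewrite lin_interp0// lin_interp1.
- rewrite lerBlDr Etra_nodes.
  have velK n : (n < N)%N -> norm2 (vel N (nodes gp) n) <= K.
    by move=> nN; exact: (disc_minimizer_vel_le symH c10 c20 ellH L0 lipH X0x0 X1x1 nN dm).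
  apply: le_trans (energy_lin_interp_le N0 contH c10 c20 ellH L0 lipH velK) _.
  (* Interpolation loses only [C / N], which is at most [C] over the root of [N] because [N] is at
     least [1]. *)
  rewrite lerD2l -/C; apply: ler_wpM2l; first by rewrite mulr_ge0// exprn_ge0.
  rewrite lef_pV2 ?posrE ?sqrtr_gt0//.
  rewrite -[leRHS](ger0_norm (ltW N0')) -sqrtr_sqr; apply: ler_wsqrtr.
  by rewrite expr2 ler_peMr ?ler1n// ltW.
- have [_ [g0 g1]] := bg.
  apply: le_trans (Edisc_sample_le contH symH c10 c20 ellH L0 lipH N0 rg).
  rewrite Edisc_sampled; apply: hmin; rewrite /= ?mul0r//.
  by rewrite divff// gt_eqF.
Qed.
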